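(* Let $1\le k\le n$ be integers and let $A\in\mathcal{M}_n(\mathbb{C})$ with $\Lambda_k(A)\neq\emptyset$. Suppose $0\notin\Lambda_k(A)$. Then for some sequence of isometries $\{M_p\}_{p\in\mathbb{N}}\subseteq\mathcal{X}_{n-k+1}$, setting $\mathcal{J}_\nu(A)=\bigcap_{p=1}^{\nu}F(M_p^*AM_p)$ for $\nu\in\mathbb{N}$, one has $$\widetilde{r}_k(A)=\lim_{\nu\to\infty}\inf\{|z|: z\in\mathcal{J}_\nu(A)\}=\sup_{\nu\in\mathbb{N}}\inf\{|z|: z\in\mathcal{J}_\nu(A)\}.$$
   Context: $\mathcal{M}_n(\mathbb{C})$ is the algebra of $n\times n$ complex matrices and $\mathcal{M}_{n,j}$ the space of $n\times j$ complex matrices; $\mathbb{N}=\{1,2,\dots\}$. For $1\le j\le n$, $\mathcal{X}_j=\{X\in\mathcal{M}_{n,j}: X^*X=I_j\}$ is the set of $n\times j$ isometries. The $k$-rank numerical range of $A$ is $\Lambda_k(A)=\{\lambda\in\mathbb{C}: X^*AX=\lambda I_k \text{ for some } X\in\mathcal{X}_k\}$, a compact convex subset of $\mathbb{C}$. For $B\in\mathcal{M}_m(\mathbb{C})$, the numerical range is $F(B)=\{x^*Bx: x\in\mathbb{C}^m,\ x^*x=1\}$. The inner $k$-rank numerical radius is $\widetilde{r}_k(A)=\min\{|z|: z\in\partial\Lambda_k(A)\}$, where $\partial$ denotes the topological boundary in $\mathbb{C}$. *)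

(* Defs.v *)
From HB Require Import structures.
From mathcomp Require Import all_boot all_order all_algebra.
From mathcomp Require Import all_classical all_reals all_analysis.
From mathcomp Require Export complex.
Import Order.TTheory GRing.Theory Num.Theory.
Import numFieldNormedType.Exports.

Set Implicit Arguments.
Unset Strict Implicit.
Unset Printing Implicit Defensive.

Local Open Scope classical_set_scope.
Local Open Scope sesquilinear_scope.
Local Open Scope ring_scope.

(* The value [0] is a default, taken only when [S] has no least element. *)
Definition set_minimum (R : realType) (S : set R) : R :=
  xget 0 (S `&` lbound S).

Lemma set_minimumE (R : realType) (S : set R) (m : R) :
  S m -> lbound S m -> set_minimum S = m.
Proof.
move=> Sm lm; rewrite /set_minimum; case: xgetP => [y _ [Sy ly]|/(_ m) []//].
by apply/eqP; rewrite eq_le; apply/andP; split; [exact: ly|exact: lm].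
Qed.

Definition boundary (T : topologicalType) (S : set T) : set T :=
  closure S `\` interior S.

(* The norm of [z : R[i]] is an element of [R[i]] with zero imaginary part;
   [modulus z] is that norm as an element of [R]. *)
Definition modulus (R : realType) (z : R[i]) : R := complex.Re `|z|.

Definition isometries (R : realType) (n j : nat) : set 'M[R[i]]_(n, j) :=
  [set X | X ^t* *m X = 1%:M].

Definition rank_numrange (R : realType) (n k : nat) (A : 'M[R[i]]_n) :
    set R[i] :=
  [set z | exists2 X : 'M[R[i]]_(n, k),
     isometries X & X ^t* *m A *m X = z%:M].

Definition numrange (R : realType) (m : nat) (B : 'M[R[i]]_m) : set R[i] :=
  [set (x ^t* *m B *m x) 0 0 | x in @isometries R m 1].

(* [R[i]] gets its topology, that of the norm, as a [numFieldType]. *)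
Definition inner_rank_radius (R : realType) (n k : nat) (A : 'M[R[i]]_n) : R :=
  set_minimum [set modulus z |
    z in boundary (rank_numrange k A : set (R[i] : numFieldType))].

Definition numrange_cap (R : realType) (n m : nat) (A : 'M[R[i]]_n)
    (M : nat -> 'M[R[i]]_(n, m)) (nu : nat) : set R[i] :=
  \bigcap_(p in [set p | (1 <= p <= nu)%N]) numrange ((M p) ^t* *m A *m M p).

(* [inf] is [0] on the empty set; this case does not occur below, because
   every isometry [M p] of size n x (n - k + 1) satisfies
   [rank_numrange k A `<=` numrange ((M p) ^t* *m A *m M p)]. *)
Definition cap_dist (R : realType) (n m : nat) (A : 'M[R[i]]_n)
    (M : nat -> 'M[R[i]]_(n, m)) (nu : nat) : R :=
  inf [set modulus z | z in numrange_cap A M nu].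

(* Main.v *)
Require Import Defs.
From mathcomp Require Import all_boot all_order all_algebra.
From mathcomp Require Import all_classical all_reals all_analysis.
From mathcomp Require Import zify ring.
Import Order.TTheory GRing.Theory Num.Theory.
Import numFieldNormedType.Exports.

(** Write [L] for the rank-[k] numerical range of [A]. It is compact and misses
    [0], so the least modulus on its boundary is attained at the point of [L]
    closest to [0] ([closest_point], [inner_rank_radiusE]). The range of an
    isometry with [n - k + 1] columns meets every subspace of dimension [k], so
    [L] lies in the numerical range of every such compression and no choice of
    the [M p] can make the distances exceed that of [L]. It remains to choose
    them so that the intersections shrink to [L].

    If the Hermitian part of [w A - q] has fewer than [k] nonnegative
    eigenvalues, its negative eigenvectors span a space of dimension at least
    [n - k + 1], and the numerical range of the compression of [A] to it lies in
    the half-plane [Re (w z) <= q] ([halfplane_isometry]). One isometry for each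
    such triple of rationals [(Re w, Im w, q)] is enough: a limit of points of
    the successive intersections lies in all these half-planes, hence satisfies
    the inequalities by which Li and Sze describe [L] ([rational_cuts]), and
    compactness turns this into convergence of the distances.

    The mathematical core is the Li-Sze theorem [pencil_semipos_isotropic]: if
    for every [w] the Hermitian part of [w A] has at least [k] nonnegative
    eigenvalues, then [A] has an isotropic subspace of dimension [k], that is,
    [0] is in [L]. Its proof here is by induction on [k] and uses no canonical
    form.

    - One moves [A] to [A - t] and to [A + s], with [t] and [s] real and as large
      as the hypothesis permits ([extremal_shift]). There some [w A] has a
      Hermitian part [H] with fewer than [k] positive eigenvalues, and comparing
      with nearby [w] on both sides produces a nonzero vector of the kernel of
      [H] on which the skew part vanishes too ([kernel_direction],
      [neutral_vector]). Passing to the orthogonal of that vector modulo the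
      vector itself lowers [k] by one and keeps the hypothesis
      ([semipos_null_reduce]); an isotropic subspace found there lifts
      ([isotropic_extend]).

    - Isotropic subspaces for [A - t] and [A + s] give one for [A]
      ([isotropic_between]), which is the convexity of [L]. On the sum of the two
      subspaces, of dimension [2 k], the form is, after a small perturbation,
      such that [w A + conj(w) A*] is invertible for all nonzero [w]. Then an
      eigenvector of the pencil is isotropic, and the same reduction, which now
      lowers the dimension by two, ends with a subspace of half the dimension
      ([rotation_unit_isotropic]).

    Subspaces are row spaces, so isometries appear as unitary rectangular
    matrices of rows. Limits are taken along an ultrafilter on [nat] finer than
    [\oo], along which every bounded sequence converges. *)

Set Implicit Arguments.
Unset Strict Implicit.
Unset Printing Implicit Defensive.

Local Open Scope sesquilinear_scope.
Local Open Scope complex_scope.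
Local Open Scope classical_set_scope.
Local Open Scope ring_scope.

(** * Forms, semidefinite and isotropic subspaces *)
Section Forms.
Variable C : numClosedFieldType.
Implicit Types (n k : nat).

Definition frm n (A : 'M[C]_n) (u v : 'rV[C]_n) : C := (u *m A *m v^t*) 0 0.

Lemma ctrD m n (A B : 'M[C]_(m, n)) : (A + B)^t* = A^t* + B^t*.
Proof. by rewrite linearD map_mxD. Qed.

Lemma ctrZ m n (a : C) (A : 'M[C]_(m, n)) : (a *: A)^t* = a^* *: A^t*.
Proof. by rewrite linearZ map_mxZ. Qed.

Lemma ctrM m n p (A : 'M[C]_(m, n)) (B : 'M[C]_(n, p)) :
  (A *m B)^t* = B^t* *m A^t*.
Proof. by rewrite trmx_mul map_mxM. Qed.

Lemma ctr_inj m n : injective (fun A : 'M[C]_(m, n) => A^t*).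
Proof. by move=> A B /(congr1 (fun X => X^t*)); rewrite !trmxCK. Qed.

Lemma ctr0 m n : (0 : 'M[C]_(m, n))^t* = 0.
Proof. by rewrite trmx0 map_mx0. Qed.

Lemma frmDl n A (u v w : 'rV[C]_n) : frm A (u + v) w = frm A u w + frm A v w.
Proof. by rewrite /frm !mulmxDl mxE. Qed.

Lemma frmDr n A (u v w : 'rV[C]_n) : frm A u (v + w) = frm A u v + frm A u w.
Proof. by rewrite /frm ctrD mulmxDr mxE. Qed.

Lemma frmZl n A a (u v : 'rV[C]_n) : frm A (a *: u) v = a * frm A u v.
Proof. by rewrite /frm -!scalemxAl mxE. Qed.

Lemma frmZr n A a (u v : 'rV[C]_n) : frm A u (a *: v) = a^* * frm A u v.
Proof. by rewrite /frm ctrZ -scalemxAr mxE. Qed.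

Lemma frmDm n A B (u v : 'rV[C]_n) : frm (A + B) u v = frm A u v + frm B u v.
Proof. by rewrite /frm mulmxDr mulmxDl mxE. Qed.

Lemma frmZm n a A (u v : 'rV[C]_n) : frm (a *: A) u v = a * frm A u v.
Proof. by rewrite /frm -scalemxAr -scalemxAl mxE. Qed.

Lemma frmNm n B (u v : 'rV[C]_n) : frm (- B) u v = - frm B u v.
Proof. by rewrite -scaleN1r frmZm mulN1r. Qed.

Lemma frm_ctr n A (u v : 'rV[C]_n) : frm (A^t*) u v = (frm A v u)^*.
Proof.
rewrite /frm -[RHS](_ : ((v *m A *m u^t*)^t*) 0 0 = _); last by rewrite !mxE.
by rewrite !ctrM trmxCK mulmxA.
Qed.

Lemma frm_conj m n (W : 'M[C]_(m, n)) A (u v : 'rV[C]_m) :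
  frm (W *m A *m W^t*) u v = frm A (u *m W) (v *m W).
Proof. by rewrite /frm ctrM !mulmxA. Qed.

Lemma frm0l n A (v : 'rV[C]_n) : frm A 0 v = 0.
Proof. by rewrite /frm !mul0mx mxE. Qed.

Lemma frm1E n (u : 'rV[C]_n) : frm 1%:M u u = \sum_i `|u 0 i| ^+ 2.
Proof.
rewrite /frm mulmx1 mxE; apply: eq_bigr => i _.
by rewrite !mxE normCK.
Qed.

Lemma frm1_gt0 n (u : 'rV[C]_n) : u != 0 -> 0 < frm 1%:M u u.
Proof.
move=> u0; rewrite frm1E lt_def sumr_ge0 ?andbT => [|i _]; last exact: exprn_ge0.
apply: contra u0 => /eqP s0; apply/eqP/rowP => i; rewrite mxE.
have h := psumr_eq0P _ s0.
have /eqP := h (fun j _ => exprn_ge0 2 (normr_ge0 (u 0 j))) i isT.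
by rewrite expf_eq0 /= normr_eq0 => /eqP.
Qed.

Lemma frm1_ge0 n (u : 'rV[C]_n) : 0 <= frm 1%:M u u.
Proof. by rewrite frm1E sumr_ge0 // => i _; rewrite exprn_ge0. Qed.

Lemma frm1_eq0 n (c : C) (u : 'rV[C]_n) :
  0 < c -> c * frm 1%:M u u = 0 -> u = 0.
Proof.
move=> c0 /eqP; rewrite mulf_eq0 gt_eqF //= => /eqP u0.
by apply/eqP; apply: contraT => /frm1_gt0; rewrite u0 ltxx.
Qed.

Definition nonneg_on n m (B : 'M[C]_n) (U : 'M[C]_(m, n)) :=
  forall x : 'rV[C]_n, (x <= U)%MS -> 0 <= 'Re (frm B x x).

(** By Courant-Fischer, this says that the Hermitian part of [B] has at least [k]
    nonnegative eigenvalues. The existential form is closed under limits and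
    restricts well to subspaces, with no perturbation theory of eigenvalues. *)
Definition semipos k n (B : 'M[C]_n) :=
  exists2 U : 'M[C]_(k, n), row_free U & nonneg_on B U.

(** A row space with this property carries the zero form: when [U] is unitary and
    [A] is shifted by [z], its conjugate transpose compresses the unshifted
    matrix to the scalar [z]. *)
Definition isotropic k n (A : 'M[C]_n) :=
  exists2 U : 'M[C]_(k, n), row_free U & U *m A *m U^t* = 0.

Lemma row_free_leq k n (U : 'M[C]_(k, n)) : row_free U -> (k <= n)%N.
Proof. by rewrite /row_free => /eqP <-; exact: rank_leq_col. Qed.

Lemma unitary_row_free k n (U : 'M[C]_(k, n)) : U \is unitarymx -> row_free U.
Proof. by move=> /mxrank_unitary; rewrite /row_free => ->. Qed.

Lemma unitarize k n (U : 'M[C]_(k, n)) : row_free U ->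
  exists2 V : 'M[C]_(k, n), V \is unitarymx & (V :=: U)%MS.
Proof.
move=> fU; exists (schmidt U); first exact/schmidt_unitarymx/(row_free_leq fU).
exact: eqmx_schmidt_free.
Qed.

Lemma sub_isotropic m k n (A : 'M[C]_n) (U : 'M[C]_(k, n)) (V : 'M[C]_(m, n)) :
  (V <= U)%MS -> U *m A *m U^t* = 0 -> V *m A *m V^t* = 0.
Proof.
move=> /submxP[D ->] h; rewrite ctrM !mulmxA -(mulmxA D) -(mulmxA D) h.
by rewrite mulmx0 mul0mx.
Qed.

Lemma subspace_dim k m n (E : 'M[C]_(m, n)) : (k <= \rank E)%N ->
  exists2 U : 'M[C]_(k, n), row_free U & (U <= E)%MS.
Proof.
move=> kE; exists (rowsub (widen_ord kE) (row_base E)).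
  have /row_freeP[D hD] := row_base_free E.
  rewrite -[X in rowsub _ X]mul1mx -mul_rowsub_mx /row_free mxrankMfree ?row_base_free //.
  have -> : rowsub (widen_ord kE) 1%:M = pid_mx k :> 'M[C]_(k, \rank E).
    by apply/matrixP => i j; rewrite !mxE ltn_ord andbT.
  by rewrite rank_pid_mx.
by rewrite (submx_trans (rowsub_sub _ _)) ?eq_row_base.
Qed.

Lemma meet_nonzero k l n (U : 'M[C]_(k, n)) (N : 'M[C]_(l, n)) :
  row_free U -> row_free N -> (n < k + l)%N ->
  exists2 x : 'rV[C]_n, x != 0 & (x <= U)%MS /\ (x <= N)%MS.
Proof.
move=> /eqP rU /eqP rN nkl.
have := mxrank_sum_cap U N; rewrite rU rN => e.
have : (U :&: N)%MS != 0.
  rewrite -mxrank_eq0 -lt0n; have := rank_leq_col (U + N)%MS.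
  by move: e nkl; set a := \rank _; set b := \rank _; lia.
move=> /rowV0Pn[x xUN x0]; exists x => //.
by move: xUN; rewrite sub_capmx => /andP.
Qed.

(** * Inertia of the Hermitian part *)
Lemma ReE2 (z : C) : 'Re z *+ 2 = z + z^*.
Proof. by rewrite -mulr_natr ReE mulfVK ?pnatr_eq0. Qed.

(** The spectral theorem for [B + B^t*], read in the coordinates [y] of an
    orthonormal eigenbasis: eigenvalue signs decide the sign of the form, and the
    zero eigenvalues its kernel. *)
Lemma spectral_split n (B : 'M[C]_n) : exists2 P : 'M[C]_n, P \is unitarymx &
  exists2 d : 'rV[C]_n, forall i, d 0 i \is Num.real &
   forall y : 'rV[C]_n,
    y *m P *m (B + B^t*) = (\row_i (y 0 i * d 0 i)) *m P /\
    'Re (frm B (y *m P) (y *m P)) *+ 2 = \sum_i d 0 i * `|y 0 i| ^+ 2.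
Proof.
set H := B + B^t*.
have hH : H \is hermsymmx.
  by apply/is_hermitianmxP; rewrite /= expr0 scale1r /H ctrD trmxCK addrC.
have /orthomx_spectralP eH := hermitian_normalmx hH.
have uP := spectral_unitarymx H.
exists (spectralmx H) => //; exists (spectral_diag H) => [i|y].
  by have /mxOverP := hermitian_spectral_diag_real hH; apply.
have yH : y *m spectralmx H *m H =
    (\row_i (y 0 i * spectral_diag H 0 i)) *m spectralmx H.
  rewrite {2}eH invmx_unitary // !mulmxA mulmxtVK //; congr (_ *m _).
  by apply/rowP => j; rewrite mul_mx_diag !mxE.
split=> //; rewrite ReE2 -frm_ctr -frmDm -/H /frm yH ctrM mulmxA mulmxtVK // mxE.
by apply: eq_bigr => i _; rewrite !mxE normCK mulrCA mulrA.
Qed.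

(** The eigenvectors with index in [S] span a subspace of dimension [#|S|]; any
    [k] of them are kept. *)
Lemma unitary_select n (S : pred 'I_n) k (P : 'M[C]_n) : P \is unitarymx ->
  (k <= #|S|)%N ->
  exists2 V : 'M[C]_(k, n), V \is unitarymx &
    forall x : 'rV[C]_n, (x <= V)%MS ->
      exists2 y : 'rV[C]_n, x = y *m P & forall i, ~~ S i -> y 0 i = 0.
Proof.
move=> uP kS; pose f (i : 'I_k) := enum_val (widen_ord kS i).
have finj : injective f.
  by move=> i j /enum_val_inj /(congr1 val) /= /val_inj.
exists (rowsub f 1%:M *m P).
  apply: mul_unitarymx => //; apply/unitarymxP/matrixP => i j; rewrite !mxE.
  rewrite (bigD1 (f i)) //= big1 ?addr0 => [|l lf]; last first.
    by rewrite !mxE eq_sym (negPf lf) mul0r.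
  by rewrite !mxE eqxx mul1r (inj_eq finj) eq_sym conjC_nat.
move=> x /submxP[z ->]; exists (z *m rowsub f 1%:M); first by rewrite mulmxA.
move=> i Si; rewrite mxE big1 // => j _; rewrite !mxE.
case: eqP => [fji|_]; last by rewrite mulr0.
by case/negP: Si; rewrite -fji; exact: (enum_valP (widen_ord kS j)).
Qed.

(** Either [k] eigenvalues of the Hermitian part are positive, or [n - k + 1] of
    them are at most [0]. In the second case the eigenvectors of the latter span a
    space on which the form vanishes only at vectors of the kernel; a subspace
    that is merely nonpositive would not give this. *)
Lemma inertia_split_kernel n k (B : 'M[C]_n) : (k <= n)%N ->
  (exists2 U : 'M[C]_(k, n), row_free U &
    forall x : 'rV[C]_n, (x <= U)%MS -> x != 0 -> 0 < 'Re (frm B x x)) \/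
  exists2 N : 'M[C]_(n - k + 1, n), N \is unitarymx &
    forall x : 'rV[C]_n, (x <= N)%MS -> 'Re (frm B x x) <= 0 /\
      ('Re (frm B x x) = 0 -> x *m (B + B^t*) = 0).
Proof.
move=> kn; have [P uP [d dR hP]] := spectral_split B.
pose S := [pred i | 0 < d 0 i].
have [kS|Sk] := leqP k #|S|; [left|right].
  have [V uV hV] := unitary_select uP kS.
  exists V; first exact: unitary_row_free.
  move=> x /hV[y -> y0] x0; have [_ e] := hP y.
  rewrite -(pmulrn_lgt0 _ (ltn0Sn 1)) e.
  have p i : 0 <= d 0 i * `|y 0 i| ^+ 2.
    have [Si|/y0->] := boolP (S i); last by rewrite normr0 expr0n mulr0.
    by rewrite mulr_ge0 ?exprn_ge0 // ltW.
  rewrite lt_def sumr_ge0 ?andbT //.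
  apply: contra x0 => /eqP s0; have/eqP -> : y == 0; last by rewrite mul0mx.
  apply/eqP/rowP => i; rewrite mxE; have [Si|/y0//] := boolP (S i).
  have /(_ i isT)/eqP := psumr_eq0P (fun j _ => p j) s0.
  by rewrite mulf_eq0 gt_eqF //= expf_eq0 /= normr_eq0 => /eqP.
have kS' : (n - k + 1 <= #|[predC S]|)%N.
  have : (#|S| + #|[predC S]| = n)%N by rewrite cardC card_ord.
  by move: Sk kn; move: #|S| #|_| => a b; lia.
have [N uN hN] := unitary_select uP kS'.
exists N => // x /hN[y -> y0]; have [yH e] := hP y.
have dn i : ~~ S i -> d 0 i <= 0 by rewrite -real_leNgt ?dR.
have p i : 0 <= - (d 0 i * `|y 0 i| ^+ 2).
  rewrite oppr_ge0; have [Sj|Sj] := boolP (S i).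
    by rewrite (y0 i) ?negbK // normr0 expr0n mulr0.
  by rewrite mulr_le0_ge0 ?exprn_ge0 ?dn.
split.
  by rewrite -(pmulrn_lle0 _ (ltn0Sn 1)) e -oppr_ge0 -sumrN sumr_ge0.
move=> R0; rewrite yH; move: e; rewrite R0 mul0rn => /esym/eqP.
rewrite -oppr_eq0 -sumrN => /eqP s0.
suff -> : \row_i (y 0 i * d 0 i) = 0 by rewrite mul0mx.
apply/rowP => i; rewrite !mxE.
have /(_ i isT)/eqP := psumr_eq0P (fun j _ => p j) s0.
by rewrite oppr_eq0 mulf_eq0 expf_eq0 /= normr_eq0 => /orP[]/eqP->;
  rewrite ?mulr0 ?mul0r.
Qed.

(** This is the previous lemma for [- B] and the complementary dimension. *)
Lemma inertia_split n k (B : 'M[C]_n) : (1 <= k <= n)%N ->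
  semipos k B \/
  exists2 N : 'M[C]_(n - k + 1, n), N \is unitarymx &
    forall x : 'rV[C]_n, (x <= N)%MS -> x != 0 -> 'Re (frm B x x) < 0.
Proof.
move=> /andP[k0 kn].
have [|[U fU hU]|] := @inertia_split_kernel n (n - k + 1) (- B); first by lia.
  have [V uV eV] := unitarize fU; right; exists V => // x.
  by rewrite eV => /hU h /h; rewrite frmNm raddfN oppr_gt0.
have -> : (n - (n - k + 1) + 1)%N = k by lia.
move=> [N uN hN]; left; exists N; first exact: unitary_row_free.
by move=> x /hN[h _]; move: h; rewrite frmNm raddfN oppr_le0.
Qed.

(** * Reduction modulo an isotropic vector *)
Lemma ker_row n (u y : 'rV[C]_n) : (u <= kermx (y^t*))%MS = (y *m u^t* == 0).
Proof.
by rewrite sub_kermx -(inj_eq (@ctr_inj _ _)) /= ctrM trmxCK ctr0.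
Qed.

(** [W] is a complement of [v] in the orthogonal of [y], a hyperplane or the whole
    space. It is a concrete model of the quotient of that orthogonal by [v]; the
    exact dimension matters when dimensions must drop by two. *)
Lemma isotropic_complement n (v y : 'rV[C]_n) : v != 0 -> y *m v^t* = 0 ->
  exists m, exists W : 'M[C]_(m, n),
    [/\ row_free W, (v :&: W)%MS = 0, y *m W^t* = 0,
        forall u : 'rV[C]_n, y *m u^t* = 0 -> (u <= v + W)%MS
      & y != 0 -> m = (n - 2)%N].
Proof.
move=> v0 yv; set K := kermx (y^t*).
have vK : (v <= K)%MS by rewrite ker_row yv.
exists (\rank (K :\: v)%MS), (row_base (K :\: v)%MS); split.
- exact: row_base_free.
- apply/eqP; rewrite -submx0 -(capmx_diff K v) capmxC.
  by rewrite capmxS // eq_row_base.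
- have : (row_base (K :\: v) <= K)%MS by rewrite eq_row_base diffmxSl.
  rewrite sub_kermx => /eqP h.
  by apply: (@ctr_inj _ _); rewrite /= ctrM trmxCK h ctr0.
- move=> u yu; have uK : (u <= K)%MS by rewrite ker_row yu.
  apply: submx_trans uK _; rewrite -(addsmx_diff_cap_eq K v) addsmxC.
  by rewrite addsmxS ?capmxSr // eq_row_base.
have := mxrank_cap_compl K v.
have -> : \rank (K :&: v)%MS = 1%N.
  have -> : (K :&: v :=: v)%MS.
    by apply/eqmxP; rewrite capmxSr sub_capmx vK submx_refl.
  by rewrite rank_rV v0.
rewrite mxrank_ker.
have ry : \rank (y^t*) = (y != 0).
  by rewrite mxrank_map mxrank_tr rank_rV.
by rewrite ry => h y0; rewrite y0 in h; lia.
Qed.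

Lemma isotropic_extend n m k (A : 'M[C]_n) (v : 'rV[C]_n) (W : 'M[C]_(m, n)) :
  v != 0 -> row_free W -> (v :&: W)%MS = 0 ->
  v *m A *m v^t* = 0 -> v *m A *m W^t* = 0 -> W *m A *m v^t* = 0 ->
  isotropic k (W *m A *m W^t*) -> isotropic k.+1 A.
Proof.
move=> v0 fW vW vv vAW WAv [Y fY hY].
rewrite -[k.+1]/(1 + k)%N; exists (col_mx v (Y *m W)).
  rewrite /row_free -addsmxE mxrank_disjoint_sum; last first.
    by apply/eqP; rewrite -submx0 -vW capmxS // submxMl.
  by rewrite rank_rV v0 mxrankMfree //; move: fY; rewrite /row_free => /eqP ->.
rewrite tr_col_mx map_row_mx mul_col_mx mul_col_row vv ctrM !mulmxA vAW mul0mx.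
have -> : Y *m W *m A *m v^t* = 0 by rewrite -!mulmxA (mulmxA W) WAv mulmx0.
by move: hY; rewrite !mulmxA => ->; rewrite block_mx0.
Qed.

(** Twice the Hermitian part of [w B]. *)
Definition rotation n (w : C) (B : 'M[C]_n) := w *: B + w^* *: B^t*.

(** The pencil spanned by the Hermitian and skew parts of [B] has an eigenvector
    [v]: both [v B] and [v B^t*] are multiples of one vector [y]. If [v] were not
    isotropic, taking conjugates would make the eigenvalue real, and some
    [rotation w B] would kill [v]. So [v] is isotropic and orthogonal, for the
    whole pencil, to the hyperplane orthogonal to [y]; on the quotient of that
    hyperplane by [v] the hypothesis persists and the dimension has dropped by
    two. *)
Lemma rotation_unit_isotropic k n (B : 'M[C]_n) : n = k.*2 ->
  (forall w, w != 0 -> rotation w B \in unitmx) -> isotropic k B.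
Proof.
elim: k n B => [|k IHk] n B nk hB.
  by exists 0; rewrite ?mul0mx // /row_free mxrank0.
set K := rotation 1 B.
have K1 : K = B + B^t* by rewrite /K /rotation conjC1 !scale1r.
have uK : K \in unitmx by apply: hB; rewrite oner_eq0.
have [mu /eigenvalueP[v ev v0]] : exists mu, eigenvalue (B *m invmx K) mu.
  by apply/eigenvalue_closed; rewrite nk.
set y := v *m K.
have vB : v *m B = mu *: y.
  by rewrite /y scalemxAl -ev mulmxA mulmxKV.
have vB' : v *m B^t* = (1 - mu) *: y.
  by rewrite scalerBl scale1r -vB /y K1 mulmxDr addrC addKr.
have vrot w : v *m rotation w B = (w * mu + w^* * (1 - mu)) *: y.
  by rewrite /rotation mulmxDr -!scalemxAr vB vB' !scalerA scalerDl.
have y0 : y != 0.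
  by apply: contra v0 => /eqP y0; rewrite -(mulmxK uK v) -/y y0 mul0mx.
have c0 w : w != 0 -> w * mu + w^* * (1 - mu) != 0.
  move=> /hB uw; apply: contra v0 => /eqP c0.
  by rewrite -(mulmxK uw v) vrot c0 scale0r mul0mx.
pose kappa := frm K v v.
have kappaR : kappa^* = kappa by rewrite /kappa -frm_ctr K1 ctrD trmxCK addrC.
have yv : y *m v^t* = kappa%:M by rewrite [LHS]mx11_scalar.
have fB : frm B v v = mu * kappa.
  by rewrite /frm vB -scalemxAl yv !mxE eqxx mulr1n.
have fB' : frm (B^t*) v v = (1 - mu) * kappa.
  by rewrite /frm vB' -scalemxAl yv !mxE eqxx mulr1n.
have kappa0 : kappa = 0.
  apply/eqP/negP => /negP k0.
  have mu1 : 1 - mu = mu^*.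
    by apply: (mulIf k0); rewrite -fB' frm_ctr fB rmorphM /= kappaR.
  have mu0 : mu != 0.
    apply/eqP => mu0; move: mu1; rewrite mu0 conjC0 subr0 => /eqP.
    by rewrite oner_eq0.
  (* This [w] makes [w * mu] purely imaginary, so [w * mu + conj (w * mu) = 0]. *)
  have w0 : 'i * mu^* != 0 by rewrite mulf_neq0 ?neq0Ci ?conjC_eq0.
  case/negP: (c0 _ w0).
  by rewrite mu1 rmorphM /= conjCi conjCK; apply/eqP; ring.
rewrite kappa0 in yv fB fB'.
have yv0 : y *m v^t* = 0 by rewrite yv raddf0.
have [m [W [fW vW yW spanW /(_ y0) mE]]] := isotropic_complement v0 yv0.
have vAW : v *m B *m W^t* = 0 by rewrite vB -scalemxAl yW scaler0.
have WAv : W *m B *m v^t* = 0.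
  apply: (@ctr_inj _ _); rewrite /= !ctrM trmxCK mulmxA vB' -scalemxAl yW.
  by rewrite scaler0 ctr0.
apply: (isotropic_extend v0 fW vW _ vAW WAv).
  by rewrite vB -scalemxAl yv0 scaler0.
apply: IHk => [|w w0]; first by rewrite mE nk; lia.
have -> : rotation w (W *m B *m W^t*) = W *m rotation w B *m W^t*.
  by rewrite /rotation !ctrM trmxCK mulmxDr mulmxDl -!scalemxAr -!scalemxAl !mulmxA.
set h := rotation w B; have uh : h \in unitmx by exact: hB.
have hh : h^t* = h by rewrite /h /rotation ctrD !ctrZ trmxCK conjCK addrC.
rewrite -row_free_unit -kermx_eq0; apply/rowV0P => u /sub_kermxP uh0.
set x := u *m W; set z := x *m h.
have zW : z *m W^t* = 0 by rewrite /z /x -uh0 !mulmxA.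
have zv : z *m v^t* = 0.
  apply: (@ctr_inj _ _); rewrite /= !ctrM trmxCK hh mulmxA vrot -scalemxAl mulmxA.
  by rewrite yW mul0mx scaler0 ctr0.
have yy : frm 1%:M y y != 0 by rewrite gt_eqF // frm1_gt0.
(* [z = u W h] is orthogonal to [v] and [W], hence a multiple of [y]. *)
pose a := frm 1%:M z y / frm 1%:M y y; pose q := z - a *: y.
have yq : y *m q^t* = 0.
  apply: (@ctr_inj _ _); rewrite /= ctrM trmxCK ctr0 [LHS]mx11_scalar.
  have -> : (q *m y^t*) 0 0 = frm 1%:M q y by rewrite /frm mulmx1.
  by rewrite /q frmDl -scaleNr frmZl mulNr divfK // subrr raddf0.
have q0 : q = 0.
  apply/eqP; apply: contraT => /frm1_gt0; rewrite /frm mulmx1.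
  have /sub_addsmxP[[b1 b2] /= qE] := spanW _ yq.
  have -> : q^t* = v^t* *m b1^t* + W^t* *m b2^t* by rewrite qE ctrD !ctrM.
  rewrite mulmxDr !mulmxA.
  have -> : q *m v^t* = 0.
    by rewrite mulmxBl zv -scalemxAl yv0 scaler0 subrr.
  have -> : q *m W^t* = 0.
    by rewrite mulmxBl zW -scalemxAl yW scaler0 subrr.
  by rewrite !mul0mx addr0 mxE ltxx.
have xv : x = (a / (w * mu + w^* * (1 - mu))) *: v.
  apply: (can_inj (mulmxK uh)); rewrite -/z -scalemxAl vrot scalerA divfK ?c0 //.
  by apply/eqP; rewrite -subr_eq0 -/q q0.
have x0 : x = 0.
  apply/eqP; rewrite -submx0 -vW sub_capmx {1}xv scalemx_sub ?submx_refl //=.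
  exact: submxMl.
have /row_freeP[D WD] := fW.
by rewrite -[u]mulmx1 -WD mulmxA -/x x0 mul0mx.
Qed.

(** Let [E] be spanned by [v] and the part of the nonnegative space [U] lying in
    the orthogonal of [v A]; the form is nonnegative on [E] since [v] is isotropic
    and orthogonal to it. Then [E] still has dimension [k + 1]: if [v] is not in
    [U], adding [v] makes up for the dimension lost in the intersection; if it is,
    a semidefinite form vanishes against its isotropic vectors, so when [w] is not
    real all of [U] is orthogonal to [v A]. Intersecting with [W] costs one
    dimension. *)
Lemma semipos_null_reduce k n m (A : 'M[C]_n) (v : 'rV[C]_n) (W : 'M[C]_(m, n))
    (w : C) :
  v != 0 -> v *m A^t* = - (v *m A) -> v *m A *m v^t* = 0 ->
  row_free W -> v *m A *m W^t* = 0 ->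
  (forall u : 'rV[C]_n, v *m A *m u^t* = 0 -> (u <= v + W)%MS) ->
  'Im w != 0 -> semipos k.+1 (w *: A) -> semipos k (w *: (W *m A *m W^t*)).
Proof.
move=> v0 vA vv fW vAW spanW Iw [U fU hU]; set y := v *m A in vA vv vAW spanW.
set Ky := kermx (y^t*).
have fvu u : frm A v u = (y *m u^t*) 0 0 by [].
have fuv u : frm A u v = - (frm A v u)^*.
  by rewrite -[A in LHS]trmxCK frm_ctr {1}/frm vA mulNmx mxE rmorphN.
have fU' (u : 'rV[C]_n) : (v <= U)%MS -> (u <= U)%MS -> y *m u^t* = 0.
  move=> vU uU; rewrite [LHS]mx11_scalar -fvu.
  set b := frm A v u; suff -> : b = 0 by rewrite raddf0.
  apply/eqP/negP => /negP b0.
  (* Along [u + i s conj(b) v] the form is affine in [s], of nonzero slope; this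
     [s] makes it equal to [-1]. *)
  have [s sR sE] : exists2 s, s \is Num.real &
      s * `|b| ^+ 2 *+ 2 * 'Im w = 'Re (frm (w *: A) u u) + 1.
    exists (('Re (frm (w *: A) u u) + 1) / (`|b| ^+ 2 *+ 2 * 'Im w)).
      by rewrite rpred_div ?rpredMn ?rpredD ?rpredM ?rpredMn ?rpred1 ?rpredX
                 ?Creal_Re ?Creal_Im ?normr_real.
    rewrite -mulrnAr -mulrA divfK // mulf_neq0 // mulrn_eq0 /=.
    by rewrite expf_eq0 /= normr_eq0.
  have := hU (u + ('i * s * b^*) *: v).
  rewrite addmx_sub ?scalemx_sub // => /(_ isT).
  rewrite frmZm !frmDr !frmDl !frmZl !frmZr fuv -/b {2}/frm -/y vv mxE.
  have -> : ('i * s * b^*)^* = - 'i * s * b.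
    by rewrite !rmorphM /= conjCi conjCK conj_Creal.
  rewrite !mulr0 addr0.
  have -> : w * (frm A u u + 'i * s * b^* * b + (- 'i * s * b) * - b^*) =
     w * frm A u u + 'i * (s * `|b| ^+ 2 *+ 2 * w).
    by rewrite normCK; ring.
  have rR : s * `|b| ^+ 2 *+ 2 \is Num.real.
    by rewrite rpredMn // rpredM // rpredX // normr_real.
  rewrite raddfD /= ReMil ImMl // -frmZm sE.
  rewrite opprD addrA subrr add0r oppr_ge0.
  by rewrite ler10.
have [V [rV VE hV]] : exists V : 'M[C]_n,
    [/\ (k.+1 <= \rank V)%N, (V <= v + W)%MS & nonneg_on (w *: A) V].
  pose E := (U :&: Ky)%MS; exists (E + v)%MS; split.
  - have [vU|vU] := boolP (v <= U)%MS.
      have UE : (U <= E)%MS.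
        rewrite sub_capmx submx_refl; apply/row_subP => i.
        by rewrite ker_row fU' ?row_sub.
      move: fU; rewrite /row_free => /eqP <-.
      by rewrite mxrankS // (submx_trans UE) // addsmxSl.
    have Ev : \rank (E :&: v)%MS = 0%N.
      apply/eqP; rewrite mxrank_eq0; apply/rowV0P => x.
      rewrite sub_capmx => /andP[xE /sub_rVP[c xc]].
      have [c0|c0] := eqVneq c 0; first by rewrite xc c0 scale0r.
      case/negP: vU; have -> : v = c^-1 *: x by rewrite xc scalerA mulVf // scale1r.
      by rewrite scalemx_sub // (submx_trans xE) // capmxSl.
    have := mxrank_sum_cap E v; rewrite Ev addn0 rank_rV v0 => ->.
    have := mxrank_sum_cap U Ky; rewrite -/E.
    have := row_free_leq fU; have -> : \rank U = k.+1 by apply/eqP; exact: fU.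
    have : (n - 1 <= \rank Ky)%N.
      by rewrite mxrank_ker leq_sub2l // rank_leq_col.
    have := rank_leq_col (U + Ky)%MS.
    by move: (\rank _) (\rank _) (\rank _) => a b c; lia.
  - rewrite addsmx_sub addsmxSl andbT; apply/row_subP => i.
    apply: spanW; apply/eqP; rewrite -ker_row.
    by rewrite (submx_trans (row_sub _ _)) // capmxSr.
  - move=> x /sub_addsmxP[[a c] /= ->].
    have /sub_rVP[c' ->] : (c *m v <= v)%MS by exact: submxMl.
    set u := a *m E; have : (u <= E)%MS by exact: submxMl.
    rewrite sub_capmx ker_row => /andP[/hU + /eqP yu].
    have vu0 : frm A v u = 0 by rewrite fvu yu mxE.
    rewrite !frmZm !frmDr !frmDl !frmZl !frmZr fuv vu0 fvu vv mxE.
    by rewrite conjC0 oppr0 !mulr0 !addr0.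
have [|X fX XE] := @subspace_dim k _ _ (V :&: W)%MS.
  have := mxrank_sum_cap V W.
  have : (\rank (V + W) <= 1 + m)%N.
    apply: (@leq_trans (\rank (v + W)%MS)).
      by rewrite mxrankS // addsmx_sub VE addsmxSr.
    rewrite (leq_trans (mxrank_adds_leqif _ _)) // leq_add ?rank_leq_row //.
  have -> : \rank W = m by apply/eqP; exact: fW.
  by move: rV; move: (\rank _) (\rank _) (\rank _) => a b c; lia.
move: XE; rewrite sub_capmx => /andP[XV /submxP[T XT]].
exists T.
  move: fX; rewrite XT /row_free => /eqP e; rewrite eqn_leq rank_leq_row /=.
  by rewrite -{1}e mxrankM_maxl.
move=> z zT; have := hV (z *m W); rewrite !frmZm -frm_conj; apply.
by apply: submx_trans XV; rewrite XT submxMr.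
Qed.

Lemma phase_real (m : C) : exists2 p, `|p| = 1 & p * m \is Num.real.
Proof.
have [->|m0] := eqVneq m 0; first by exists 1; rewrite ?normr1 ?mulr0.
exists (m^* / `|m|).
  by rewrite normf_div norm_conjC normr_id divff // normr_eq0.
by rewrite mulrAC [_ * m]mulrC -normCK rpred_div ?rpredX ?normr_real.
Qed.

(** On the kernel of the Hermitian part the form is ['i] times a real quadratic
    form, which takes values of both signs at [x1] and [x2]. Rotating the phase of
    [x2] kills the cross terms, and then a suitable multiple balances the two
    values. *)
Lemma neutral_vector n (A : 'M[C]_n) (x1 x2 : 'rV[C]_n) :
  x1 != 0 -> x1 *m (A + A^t*) = 0 -> 0 <= 'Im (frm A x1 x1) ->
  x2 != 0 -> x2 *m (A + A^t*) = 0 -> 'Im (frm A x2 x2) <= 0 ->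
  exists v : 'rV[C]_n, [/\ v != 0, v *m A^t* = - (v *m A) & v *m A *m v^t* = 0].
Proof.
move=> x10 x1A a0 x20 x2A b0.
have skew (x : 'rV[C]_n) : x *m (A + A^t*) = 0 -> x *m A^t* = - (x *m A).
  by rewrite mulmxDr addrC => /eqP; rewrite addr_eq0 => /eqP.
have fconj (x z : 'rV[C]_n) : x *m (A + A^t*) = 0 -> frm A z x = - (frm A x z)^*.
  by move=> /skew h; rewrite -[A in LHS]trmxCK frm_ctr {1}/frm h mulNmx mxE rmorphN.
have fIm (x : 'rV[C]_n) : x *m (A + A^t*) = 0 -> frm A x x = 'i * 'Im (frm A x x).
  move=> /(fconj x x) h; rewrite {1}(Crect (frm A x x)) ReE.
  by rewrite {1}h addNr mul0r add0r.
have f0 (x : 'rV[C]_n) : frm A x x = 0 -> x *m A *m x^t* = 0.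
  by move=> h; rewrite [LHS]mx11_scalar [_ 0 0]h raddf0.
have [az|an] := eqVneq ('Im (frm A x1 x1)) 0.
  by exists x1; split; [|exact: skew|apply: f0; rewrite fIm // az mulr0].
have [bz|bn] := eqVneq ('Im (frm A x2 x2)) 0.
  by exists x2; split; [|exact: skew|apply: f0; rewrite fIm // bz mulr0].
set a := 'Im _ in a0 an; set b := 'Im _ in b0 bn.
have {an}a0 : 0 < a by rewrite lt_def an.
have {bn}b0 : b < 0 by rewrite lt_def eq_sym bn.
have [p p1 pR] := phase_real (frm A x2 x1).
pose s := sqrtC (- a / b); have s2 : s ^+ 2 = - a / b by rewrite sqrtCK.
have sp : 0 < s by rewrite sqrtC_gt0 mulNr -mulrN -invrN divr_gt0 ?oppr_gt0.
have sR : s \is Num.real by exact: gtr0_real.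
set c := s * p; have cc : c^* * c = - a / b.
  by rewrite mulrC -normCK normrM p1 mulr1 real_normK.
exists (x1 + c *: x2); split.
- apply: contraTneq (a0) => /eqP; rewrite addr_eq0 => /eqP x1E.
  rewrite /a x1E -scaleNr frmZl frmZr [- c * _]mulrA rmorphN mulrNN mulrC.
  rewrite [c * _]mulrC cc mulrC ImMl ?rpred_div ?rpredN ?Creal_Im // -/b.
  by rewrite mulfVK ?lt_eqF // oppr_gt0 lt_gtF.
- by apply: skew; rewrite mulmxDl x1A add0r -scalemxAl x2A scaler0.
apply: f0; rewrite !frmDr !frmDl !frmZl !frmZr (fconj _ x1 x2A).
rewrite (fIm x1) // (fIm x2) // -/a -/b.
have h : c * frm A x2 x1 = c^* * (frm A x2 x1)^*.
  rewrite -rmorphM /= conj_Creal // /c -mulrA rpredM //.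
transitivity ('i * a + (c * frm A x2 x1 - c^* * (frm A x2 x1)^*)
              + c^* * c * ('i * b)); first by ring.
by rewrite h subrr addr0 cc; field; rewrite lt_eqF.
Qed.

(** On this block form [rotation w] is positive on one summand and negative on the
    other, or the opposite, unless [w] is purely imaginary; there it is
    off-diagonal with blocks proportional to [M - N^t*] and its adjoint. Hence it
    is always invertible. *)
Lemma isotropic_hyperbolic k (t s : C) (M N : 'M[C]_k) : 0 < t -> 0 < s ->
  M - N^t* \in unitmx -> isotropic k (block_mx t%:M M N (- s)%:M).
Proof.
move=> t0 s0 uMN; apply: rotation_unit_isotropic => [|w w0].
  by rewrite addnn.
pose P := w *: M + w^* *: N^t*; pose r := w + w^*.
have rR : r^* = r by rewrite /r rmorphD /= conjCK addrC.
have -> : rotation w (block_mx t%:M M N (- s)%:M) =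
    block_mx (r * t)%:M P (P^t*) (- (r * s))%:M.
  rewrite /rotation tr_block_mx map_block_mx !scale_block_mx add_block_mx.
  have ct : t^* = t by rewrite conj_Creal ?gtr0_real.
  have cs : (- s)^* = - s by rewrite conj_Creal ?rpredN ?gtr0_real.
  rewrite !tr_scalar_mx !map_scalar_mx /= ct cs.
  have scalE c : w *: c%:M + w^* *: c%:M = (r * c)%:M :> 'M[C]_k.
    by rewrite -scalerDl scale_scalar_mx.
  rewrite !scalE mulrN; congr block_mx.
  by rewrite /P ctrD !ctrZ trmxCK conjCK addrC.
rewrite -row_free_unit -kermx_eq0; apply/rowV0P => u /sub_kermxP.
rewrite -[u]hsubmxK; set x1 := lsubmx u; set x2 := rsubmx u.
rewrite mul_row_block -[0](row_mx0) => /eq_row_mx[].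
rewrite !mul_mx_scalar => e1 e2.
have [r0|r0] := eqVneq r 0.
  move: e1 e2; rewrite r0 !mul0r oppr0 !scale0r add0r addr0 => e1 e2.
  have uP : P \in unitmx.
    have -> : P = w *: (M - N^t*).
      rewrite /P scalerBr; have -> : w^* = - w.
        by apply/eqP; rewrite -addr_eq0 addrC -/r r0.
      by rewrite scaleNr.
    by rewrite unitmxZ // unitfE.
  have -> : x1 = 0 by rewrite -(mulmxK uP x1) e2 mul0mx.
  have uP' : P^t* \in unitmx by rewrite map_unitmx unitmx_tr.
  by rewrite -(mulmxK uP' x2) e1 mul0mx row_mx0.
have h1 : r * t * frm 1%:M x1 x1 + frm (P^t*) x2 x1 = 0.
  have := frm0l 1%:M x1; rewrite -[X in frm _ X]e1 frmDl frmZl => <-.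
  by congr (_ + _); rewrite /frm mulmx1.
have h2 : frm P x1 x2 - r * s * frm 1%:M x2 x2 = 0.
  have := frm0l 1%:M x2; rewrite -[X in frm _ X]e2 frmDl frmZl mulNr => <-.
  by congr (_ + _); rewrite /frm mulmx1.
have e : t * frm 1%:M x1 x1 + s * frm 1%:M x2 x2 = 0.
  apply: (mulfI r0); rewrite mulr0 mulrDr !mulrA -[RHS]h1; congr (_ + _).
  rewrite frm_ctr; move/eqP: h2; rewrite subr_eq0 => /eqP ->.
  by rewrite !rmorphM /= rR !conj_Creal ?ger0_real ?frm1_ge0 // ltW.
move/eqP: e; rewrite paddr_eq0 ?(mulr_ge0 (ltW _)) ?frm1_ge0 //.
by move=> /andP[/eqP/(frm1_eq0 t0)-> /eqP/(frm1_eq0 s0)->]; rewrite row_mx0.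
Qed.

Lemma isotropic_compress k m n (A : 'M[C]_n) (V : 'M[C]_(m, n)) : row_free V ->
  isotropic k (V *m A *m V^t*) -> isotropic k A.
Proof.
move=> fV [U fU hU]; exists (U *m V); first by rewrite /row_free mxrankMfree.
by rewrite ctrM !mulmxA in hU *.
Qed.

Lemma isotropicZ k n (A : 'M[C]_n) (a : C) : a != 0 ->
  isotropic k (a *: A) -> isotropic k A.
Proof.
move=> a0 [U fU]; rewrite -scalemxAr -scalemxAl => /eqP.
by rewrite scalemx_eq0 (negPf a0) => /eqP hU; exists U.
Qed.

Lemma semiposZ k n (B : 'M[C]_n) (c : C) : 0 <= c ->
  semipos k B -> semipos k (c *: B).
Proof.
move=> c0 [U fU hU]; exists U => // x /hU h.
by rewrite frmZm ReMl ?ger0_real // mulr_ge0.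
Qed.

Lemma semipos_leq k l n (B : 'M[C]_n) : (l <= k)%N -> semipos k B -> semipos l B.
Proof.
move=> lk [U fU hU].
have [|V fV VU] := @subspace_dim l _ _ U; first by move: fU => /eqP ->.
by exists V => // x xV; apply: hU; apply: submx_trans VU.
Qed.
End Forms.

(** * Limits of matrices along a filter *)
Section EntrywiseLimits.
Variables (K : numClosedFieldType) (F : set_system nat).
Context {FF : ProperFilter F}.
Local Notation KT := (K : numFieldType).

Definition mxlim m n (X_ : nat -> 'M[K]_(m, n)) (X : 'M[K]_(m, n)) :=
  forall i j, (fun t => X_ t i j : KT) @ F --> (X i j : KT).

Lemma mxlim_cst m n (X : 'M[K]_(m, n)) : mxlim (fun=> X) X.
Proof. by move=> i j; exact: cvg_cst. Qed.

Lemma mxlimM m n p (X_ : nat -> 'M[K]_(m, n)) X (Y_ : nat -> 'M[K]_(n, p)) Y :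
  mxlim X_ X -> mxlim Y_ Y -> mxlim (fun t => X_ t *m Y_ t) (X *m Y).
Proof.
move=> hX hY i j.
rewrite [X in X @ _ --> _](_ : _ = fun t => \sum_l X_ t i l * Y_ t l j); last first.
  by apply/funext => t; rewrite mxE.
rewrite mxE.
by apply: (@cvg_big KT _ +%R 0 predT add_continuous) => l _; apply: cvgM.
Qed.

Lemma cvg_conj (f : nat -> K) (l : K) :
  (f : nat -> KT) @ F --> (l : KT) -> (fun t => (f t)^* : KT) @ F --> (l^* : KT).
Proof.
move=> /cvgrPdist_le h; apply/cvgrPdist_le => e e0.
by apply: filterS (h e e0) => t; rewrite -rmorphB norm_conjC.
Qed.

Lemma mxlim_ctr m n (X_ : nat -> 'M[K]_(m, n)) X :
  mxlim X_ X -> mxlim (fun t => (X_ t)^t*) (X^t*).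
Proof.
move=> h i j.
rewrite [X in X @ _ --> _](_ : _ = fun t => (X_ t j i)^*); last first.
  by apply/funext => t; rewrite !mxE.
by rewrite !mxE; apply: cvg_conj.
Qed.

Lemma mxlim_unique m n (X_ : nat -> 'M[K]_(m, n)) X Y :
  mxlim X_ X -> mxlim X_ Y -> X = Y.
Proof.
move=> hX hY; apply/matrixP => i j.
by apply: (@cvg_unique _ (@norm_hausdorff _ KT)) (hX i j) (hY i j).
Qed.

Lemma cvg_Re_ge0 (f : nat -> K) (l : K) : (\forall t \near F, 0 <= 'Re (f t)) ->
  (f : nat -> KT) @ F --> (l : KT) -> 0 <= 'Re l.
Proof.
move=> f0 /cvgrPdist_le h; rewrite real_leNgt ?Creal_Re //; apply/negP => l0.
have e0 : 0 < - 'Re l / 2 by rewrite divr_gt0 ?oppr_gt0.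
have [t [+ ht]] := filter_ex (filterI f0 (h _ e0)); apply/negP.
rewrite -real_ltNge ?Creal_Re //.
have : 'Re (f t - l) <= - 'Re l / 2.
  apply: le_trans ht; rewrite distrC (le_trans (real_ler_norm _)) ?Creal_Re //.
  by have [] := leif_normC_Re_Creal (f t - l).
rewrite raddfB /= lerBlDr => /le_lt_trans; apply.
by rewrite -[X in _ + X]opprK subr_lt0 ltr_pdivrMr // mulr_natr mulr2n ltrDl oppr_gt0.
Qed.

Lemma mxlimZ m n (f : nat -> K) (l : K) (X_ : nat -> 'M[K]_(m, n)) X :
  (f : nat -> KT) @ F --> (l : KT) -> mxlim X_ X ->
  mxlim (fun t => f t *: X_ t) (l *: X).
Proof.
move=> hf hX i j.
rewrite [X in X @ _ --> _](_ : _ = fun t => f t * X_ t i j).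
  by rewrite mxE; exact: cvgM.
by apply/funext => t; rewrite mxE.
Qed.

Lemma mxlimD m n (Y_ X_ : nat -> 'M[K]_(m, n)) Y X :
  mxlim Y_ Y -> mxlim X_ X -> mxlim (fun t => Y_ t + X_ t) (Y + X).
Proof.
move=> hY hX i j.
rewrite [X in X @ _ --> _](_ : _ = fun t => Y_ t i j + X_ t i j).
  by rewrite mxE; exact: cvgD.
by apply/funext => t; rewrite mxE.
Qed.

Lemma mxlim_frm n (A_ : nat -> 'M[K]_n) A (u_ v_ : nat -> 'rV[K]_n) u v :
  mxlim A_ A -> mxlim u_ u -> mxlim v_ v ->
  (fun t => frm (A_ t) (u_ t) (v_ t) : KT) @ F --> (frm A u v : KT).
Proof.
move=> hA hu hv; have h := mxlimM (mxlimM hu hA) (mxlim_ctr hv).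
exact: (h 0 0).
Qed.

End EntrywiseLimits.

(** * Compactness of the set of isometries *)
Lemma ultra_fmap (T U : Type) (f : T -> U) (F : set_system T) :
  UltraFilter F -> UltraFilter (f @ F).
Proof.
move=> FU; split; first exact: fmap_proper_filter.
move=> G GF FG; rewrite eqEsubset; split => // A GA.
have [//|FnA] := in_ultra_setVsetC (f @^-1` A) FU.
have GnA : G (~` A) by exact: FG.
by have /filter_ex[? []] : G (A `&` ~` A) by exact: filterI.
Qed.

Section Complex.
Variable R : realType.
Local Notation C := R[i].
Local Notation CT := (R[i] : numFieldType).

Lemma normCr (x : R) : `|x%:C| = `|x|%:C :> C.
Proof. by rewrite normc_def /= expr0n addr0 sqrtr_sqr. Qed.

Lemma normci : `|'i%C : C| = 1.
Proof. by rewrite normc_def /= expr0n add0r expr1n sqrtr1. Qed.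

Lemma normc_ge_Im (z : C) : `|complex.Im z|%:C <= `|z|.
Proof. by rewrite -normrN -ReiNIm (le_trans (normc_ge_Re _)) // normrM normci mulr1. Qed.

Lemma modulusE (z : C) : (modulus z)%:C = `|z|.
Proof. by rewrite RRe_real ?normr_real. Qed.

(** Real and imaginary parts stay in a compact segment, where ultrafilters
    converge. This replaces the extraction of subsequences. *)
Lemma ultra_cvg (F : set_system nat) (f : nat -> C) (M : R) : UltraFilter F ->
  (forall t, modulus (f t) <= M) -> exists l : C, (f : nat -> CT) @ F --> (l : CT).
Proof.
move=> FU fM.
have realcvg (g : nat -> R) : (forall t, `|g t| <= M) -> exists a : R, g @ F --> a.
  move=> gM; have := @segment_compact R (- M) M; rewrite compact_ultra.
  move=> /(_ (g @ F) (ultra_fmap _ _)) [|a [_ ga]]; last by exists a.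
  by apply: (@filterE _ F) => t; rewrite /= in_itv /= -ler_norml.
have lecM (x : R) (z : C) : `|x%:C| <= `|z| -> modulus z <= M -> `|x| <= M.
  by rewrite normCr -(modulusE z) lecR; exact: le_trans.
have [a ha] : exists a : R, (fun t => complex.Re (f t)) @ F --> a.
  by apply: realcvg => t; apply: (lecM _ (f t)) => //; rewrite normCr; exact: normc_ge_Re.
have [b hb] : exists b : R, (fun t => complex.Im (f t)) @ F --> b.
  apply: realcvg => t; apply: (lecM _ (f t)) => //.
  by rewrite normCr normc_ge_Im.
exists (a +i* b)%C; apply/cvgrPdist_le => e e0.
have eE : e = (complex.Re e)%:C by rewrite RRe_real // gtr0_real.
have e2 : 0 < complex.Re e / 2 by move: e0; rewrite eE ltcR => ?; rewrite divr_gt0.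
move/cvgrPdist_le: ha => /(_ _ e2) ha; move/cvgrPdist_le: hb => /(_ _ e2) hb.
near=> t.
have ta : `|a - complex.Re (f t)| <= complex.Re e / 2 by near: t.
have tb : `|b - complex.Im (f t)| <= complex.Re e / 2 by near: t.
have -> : (a +i* b)%C - f t =
    (a - complex.Re (f t))%:C + 'i%C * (b - complex.Im (f t))%:C.
  by rewrite [LHS]complexE; case: (f t).
rewrite (le_trans (ler_normD _ _)) // normrM !normCr.
by rewrite normci mul1r -raddfD /= eE lecR [leRHS]splitr lerD.
Unshelve. all: by end_near. Qed.

End Complex.

Section Compactness.
Variable R : realType.
Local Notation C := R[i].
Local Notation CT := (R[i] : numFieldType).

Lemma ultra_nat : exists2 F : set_system nat, UltraFilter F & \oo `<=` F.
Proof.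
have [F [FU h]] := @ultraFilterLemma nat \oo _.
by exists F.
Qed.

Lemma realCr (x : R) : x%:C \is @Num.real C.
Proof. by rewrite complex_real. Qed.

Lemma conjCr (x : R) : (x%:C : C)^*%R = x%:C.
Proof. by rewrite conj_Creal ?realCr. Qed.

Lemma unitary_entry k n (V : 'M[C]_(k, n)) i j : V \is unitarymx -> `|V i j| <= 1.
Proof.
move=> /unitarymxP/matrixP/(_ i i); rewrite !mxE eqxx => h.
rewrite -(@expr_le1 _ 2) // -[leRHS]h (bigD1 j) //= !mxE -normCK lerDl.
by apply: sumr_ge0 => l _; rewrite !mxE mul_conjC_ge0.
Qed.

Variables (F : set_system nat).
Hypotheses (FU : UltraFilter F) (Foo : \oo `<=` F).

Lemma cvg_inv_bound (f : nat -> C) (l : C) :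
  (forall t, `|l - f t| <= (t.+1%:R^-1)%:C) -> (f : nat -> CT) @ F --> (l : CT).
Proof.
move=> h; apply/cvgrPdist_le => e e0; apply: Foo.
have eE : e = (complex.Re e)%:C by rewrite RRe_real // gtr0_real.
have {}e0 : 0 < complex.Re e by move: e0; rewrite eE ltcR.
apply: filterS (near_infty_natSinv_lt (PosNum e0)) => t /= ht.
by rewrite (le_trans (h t)) // eE lecR ltW.
Qed.

Lemma unitary_lim k n (V_ : nat -> 'M[C]_(k, n)) :
  (forall t, V_ t \is unitarymx) -> exists2 V, V \is unitarymx & mxlim F V_ V.
Proof.
move=> uV.
have h (ij : 'I_k * 'I_n) : exists l : C,
    (fun t => V_ t ij.1 ij.2 : CT) @ F --> (l : CT).
  apply: (@ultra_cvg R F _ 1) => t; rewrite -lecR modulusE.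
  exact: unitary_entry.
have [l hl] := choice h.
exists (\matrix_(i, j) l (i, j)) => [|i j]; last by rewrite mxE; exact: (hl (i, j)).
apply/unitarymxP.
have hV : mxlim F V_ (\matrix_(i, j) l (i, j)).
  by move=> i j; rewrite mxE; exact: (hl (i, j)).
apply: (mxlim_unique (mxlimM hV (mxlim_ctr hV))).
rewrite [X in mxlim _ X _](_ : _ = fun=> 1%:M); first exact: mxlim_cst.
by apply/funext => t; apply/unitarymxP.
Qed.

Lemma semipos_lim k n (B_ : nat -> 'M[C]_n) B : mxlim F B_ B ->
  (forall t, semipos k (B_ t)) -> semipos k B.
Proof.
move=> hB sB.
have /choice[V_ hV_] : forall t, exists V : 'M[C]_(k, n),
    V \is unitarymx /\ nonneg_on (B_ t) V.
  move=> t; have [U fU hU] := sB t; have [V uV eV] := unitarize fU.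
  by exists V; split => // x; rewrite eV; exact: hU.
have [V uV hV] := unitary_lim (fun t => (hV_ t).1).
exists V; first exact: unitary_row_free.
move=> _ /submxP[z ->]; rewrite -frm_conj.
have zz : mxlim F (fun=> z) z by exact: mxlim_cst.
have hf : (fun t => frm (V_ t *m B_ t *m (V_ t)^t*) z z : CT) @ F -->
          (frm (V *m B *m V^t*) z z : CT).
  by apply: (mxlim_frm (mxlimM (mxlimM hV hB) (mxlim_ctr hV)) zz zz).
apply: (cvg_Re_ge0 _ hf); apply: nearW => t; rewrite frm_conj.
by apply: (hV_ t).2; exact: submxMl.
Qed.

Lemma isotropic_lim k n (A_ : nat -> 'M[C]_n) A : mxlim F A_ A ->
  (forall t, isotropic k (A_ t)) -> isotropic k A.
Proof.
move=> hA sA.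
have /choice[V_ hV_] : forall t, exists V : 'M[C]_(k, n),
    V \is unitarymx /\ V *m A_ t *m V^t* = 0.
  move=> t; have [U fU hU] := sA t; have [V uV eV] := unitarize fU.
  by exists V; split => //; apply: sub_isotropic hU; rewrite eV.
have [V uV hV] := unitary_lim (fun t => (hV_ t).1).
exists V; first exact: unitary_row_free.
apply: (mxlim_unique (mxlimM (mxlimM hV hA) (mxlim_ctr hV))).
rewrite [X in mxlim _ X _](_ : _ = fun=> 0); first exact: mxlim_cst.
by apply/funext => t; exact: (hV_ t).2.
Qed.

End Compactness.

(** * Convexity and the Li-Sze theorem *)
Section HigherRank.
Variable R : realType.
Local Notation C := R[i].
Local Notation CT := (R[i] : numFieldType).

Lemma perturb_unit k (D : 'M[C]_k) (e : R) : 0 < e ->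
  exists eps : R, [/\ 0 < eps, eps <= e & D + eps%:C%:M \in unitmx].
Proof.
move=> e0; pose p := char_poly (- D).
(* More candidates than the characteristic polynomial has roots. *)
pose s := [seq (e / i.+1%:R)%:C | i <- iota 0 k.+1].
have us : uniq s.
  rewrite map_inj_in_uniq ?iota_uniq // => i j _ _ /complexI.
  move=> /(mulfI (lt0r_neq0 e0))/invr_inj/eqP.
  by rewrite eqr_nat => /eqP[].
have p0 : p != 0 by rewrite monic_neq0 // char_poly_monic.
have : ~~ all (root p) s.
  apply/negP => /(max_poly_roots p0)/(_ us).
  by rewrite size_char_poly size_map size_iota ltnn.
move=> /allPn[_ /mapP[i _ ->]]; rewrite -eigenvalue_root_char => h.
exists (e / i.+1%:R); split; first by rewrite divr_gt0.
  by rewrite ler_piMr ?(ltW e0) // invf_le1 ?ler1n ?ltr0n.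
rewrite -row_free_unit -kermx_eq0; apply: contraNT h => /rowV0Pn[x].
move=> /sub_kermxP; rewrite mulmxDr mul_mx_scalar => xD x0.
apply/eigenvalueP; exists x => //.
by rewrite mulmxN; apply/eqP; rewrite eqr_oppLR -addr_eq0 xD.
Qed.

(** Convexity of the higher-rank numerical range, at the point [0] of the segment
    from [t] to [- s]. The two isotropic subspaces meet trivially, since the form of
    [A] is positive on one and negative on the other; on their sum [A] has the
    block form of [isotropic_hyperbolic], up to a perturbation of one corner that
    makes the off-diagonal difference invertible. *)
Lemma isotropic_between k n (A : 'M[C]_n) (t s : R) : 0 <= t -> 0 <= s ->
  isotropic k (A - t%:C%:M) -> isotropic k (A + s%:C%:M) -> isotropic k A.
Proof.
rewrite !le_eqVlt => /predU1P[<-|t0]; first by rewrite -[0%:C]/(0 : C) raddf0 subr0.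
move=> /predU1P[<-|s0]; first by rewrite -[0%:C]/(0 : C) raddf0 addr0.
have [F FU Foo] := ultra_nat.
move=> [X' fX' hX'] [Y' fY' hY'].
have [X uX eX] := unitarize fX'; have [Y uY eY] := unitarize fY'.
have XX := unitarymxP uX; have YY := unitarymxP uY.
have XAX : X *m A *m X^t* = t%:C%:M.
  have /eqP : X *m (A - t%:C%:M) *m X^t* = 0 by apply: sub_isotropic hX'; rewrite eX.
  rewrite mulmxBr mulmxBl mul_mx_scalar -scalemxAl XX scalemx1 subr_eq0.
  by move=> /eqP.
have YAY : Y *m A *m Y^t* = (- s%:C)%:M.
  have /eqP : Y *m (A + s%:C%:M) *m Y^t* = 0 by apply: sub_isotropic hY'; rewrite eY.
  rewrite mulmxDr mulmxDl mul_mx_scalar -scalemxAl YY scalemx1 addr_eq0.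
  by move=> /eqP ->; rewrite raddfN.
have tC : 0 < t%:C :> C by rewrite ltcR.
have sC : 0 < s%:C :> C by rewrite ltcR.
have fV : row_free (col_mx X Y).
  rewrite -kermx_eq0; apply/rowV0P => u /sub_kermxP.
  rewrite -[u]hsubmxK; set a := lsubmx u; set b := rsubmx u.
  rewrite mul_row_col => /eqP; rewrite addr_eq0 => /eqP ab.
  have : frm A (a *m X) (a *m X) = frm A (b *m Y) (b *m Y).
    by rewrite ab -scaleN1r frmZl frmZr mulrA rmorphN1 mulrNN !mul1r.
  rewrite -!frm_conj XAX YAY -[t%:C%:M]scalemx1 -[(- s%:C)%:M]scalemx1.
  rewrite !frmZm mulNr => /eqP.
  rewrite -addr_eq0 paddr_eq0 ?(mulr_ge0 (ltW _)) ?frm1_ge0 //.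
  move=> /andP[/eqP/(frm1_eq0 tC)-> /eqP/(frm1_eq0 sC)->].
  by rewrite row_mx0.
apply: (isotropic_compress fV).
rewrite tr_col_mx map_row_mx mul_col_mx mul_col_row XAX YAY.
set M := X *m A *m _; set N := Y *m A *m _.
have /choice[eps hep] : forall j : nat, exists eps : R, [/\ 0 < eps,
    eps <= j.+1%:R^-1 & (M - N^t*) + eps%:C%:M \in unitmx].
  by move=> j; apply: perturb_unit.
apply: (@isotropic_lim _ F FU _ _ (fun j =>
    block_mx t%:C%:M M (N - (eps j)%:C%:M) (- s%:C)%:M)) => [|j]; last first.
  apply: isotropic_hyperbolic => //; have [_ _] := hep j.
  have -> : (N - (eps j)%:C%:M)^t* = N^t* - (eps j)%:C%:M.
    by rewrite linearB map_mxB /= tr_scalar_mx map_scalar_mx /= conjCr.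
  by rewrite opprB addrA addrAC.
set B0 := block_mx t%:C%:M M N _.
pose E : 'M[C]_(k + k) := block_mx 0 0 (- 1%:M) 0.
have blockE (c : C) : block_mx t%:C%:M M (N - c%:M) (- s%:C)%:M = B0 + c *: E.
  rewrite scale_block_mx add_block_mx !scaler0 !addr0 scalerN scalemx1.
  by [].
under [X in mxlim _ X _]funext do rewrite blockE.
suff h : mxlim F (fun j => B0 + (eps j)%:C *: E) (B0 + 0 *: E).
  by rewrite scale0r addr0 in h.
apply: (@mxlimD C F _ _ _ (fun=> B0) (fun j => (eps j)%:C *: E)).
  exact: mxlim_cst.
apply: (@mxlimZ C F _ _ _ (fun j => (eps j)%:C)); last exact: mxlim_cst.
apply: (cvg_inv_bound FU Foo) => j; have [e0 ej _] := hep j.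
by rewrite sub0r normrN normCr lecR gtr0_norm.
Qed.

Lemma frm_scalar n (c : C) (u v : 'rV[C]_n) : frm c%:M u v = c * frm 1%:M u v.
Proof. by rewrite -[c%:M]scalemx1 frmZm. Qed.

Lemma frm_shift n A (c : C) (u v : 'rV[C]_n) :
  frm (A - c%:M) u v = frm A u v - c * frm 1%:M u v.
Proof. by rewrite frmDm frmNm frm_scalar. Qed.

Lemma frm1_unitary n (u : 'rV[C]_n) : u \is unitarymx -> frm 1%:M u u = 1.
Proof. by move=> /unitarymxP uu; rewrite /frm mulmx1 uu mxE eqxx. Qed.

Lemma frm_bound n (A : 'M[C]_n) (u : 'rV[C]_n) : u \is unitarymx ->
  `|frm A u u| <= \sum_j \sum_i `|A i j|.
Proof.
move=> uu; rewrite /frm mxE (le_trans (ler_norm_sum _ _ _)) //; apply: ler_sum => j _.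
rewrite normrM !mxE norm_conjC (le_trans (ler_piMr _ (unitary_entry _ _ uu))) //.
rewrite (le_trans (ler_norm_sum _ _ _)) //; apply: ler_sum => i _.
by rewrite normrM ler_piMl // unitary_entry.
Qed.

Lemma semipos_unit k n (B : 'M[C]_n) : (0 < k)%N -> semipos k B ->
  exists2 u : 'rV[C]_n, u \is unitarymx & 0 <= 'Re (frm B u u).
Proof.
move=> k0 /(semipos_leq k0)[U fU hU]; have [u uu eu] := unitarize fU.
by exists u => //; apply: hU; rewrite eu.
Qed.

Lemma cvg_add_inv (F : set_system nat) (a d : C) :
  UltraFilter F -> \oo `<=` F -> `|d| <= 1 ->
  ((fun j => a + d * (j.+1%:R^-1 : R)%:C) : nat -> CT) @ F --> (a : CT).
Proof.
move=> FU Foo d1; apply: (cvg_inv_bound FU Foo) => j.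
rewrite opprD addrA subrr add0r normrN normrM normCr [`|_^-1|]ger0_norm ?invr_ge0 //.
by rewrite ler_piMl // ler0c invr_ge0.
Qed.

(** The inequalities of Li and Sze at the point [0]: in every direction [w], the
    [k]-th largest eigenvalue of the Hermitian part of [w A] is nonnegative. *)
Definition pencil_semipos k n (A : 'M[C]_n) := forall w : C, semipos k (w *: A).

Lemma cvg_mxlim_shift n (A : 'M[C]_n) (F : set_system nat) (f w : nat -> C) l v :
  ProperFilter F ->
  (f : nat -> CT) @ F --> (l : CT) -> (w : nat -> CT) @ F --> (v : CT) ->
  mxlim F (fun j => w j *: (A - (f j)%:M)) (v *: (A - l%:M)).
Proof.
move=> FF hf hw; apply: (@mxlimZ C F _ _ _ w); first exact: hw.
have -> : (fun j => A - (f j)%:M) = (fun j => A + f j *: (- 1%:M)).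
  by apply/funext => j; rewrite scalerN scalemx1.
have -> : A - l%:M = A + l *: (- 1%:M) by rewrite scalerN scalemx1.
apply: (@mxlimD C F _ _ _ (fun=> A) (fun j => f j *: (- 1%:M))).
  exact: mxlim_cst.
by apply: (@mxlimZ C F _ _ _ f); [exact: hf|exact: mxlim_cst].
Qed.

(** Take [t] maximal. Just beyond [t] the condition fails for some unit [w], which
    means that [n - k + 1] eigenvalues are negative there; in the limit they are at
    most [0] for a limit of those [w]. *)
Lemma extremal_shift k n (A : 'M[C]_n) : (0 < k)%N -> pencil_semipos k A ->
  exists2 t : R, 0 <= t & pencil_semipos k (A - t%:C%:M) /\
    exists2 w : C, w != 0 & semipos (n - k + 1) (- (w *: (A - t%:C%:M))).
Proof.
move=> k0 hA; have [F FU Foo] := ultra_nat.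
have kn : (k <= n)%N by have [U fU _] := hA 1; exact: row_free_leq fU.
pose S := [set t : R | pencil_semipos k (A - t%:C%:M)].
have S0 : S 0 by move=> w; rewrite -[0%:C]/(0 : C) raddf0 subr0; exact: hA.
pose b : C := \sum_j \sum_i `|A i j|.
have bR : b = (complex.Re b)%:C.
  by rewrite RRe_real // ger0_real // sumr_ge0 // => j _; rewrite sumr_ge0.
have ubS : ubound S (complex.Re b).
  move=> t /(_ 1)/(semipos_unit k0)[u uu].
  rewrite scale1r frm_shift frm1_unitary // mulr1 raddfB /=.
  rewrite (Creal_ReP _ (realCr t)) subr_ge0 => tu.
  rewrite -lecR -bR (le_trans tu) // (le_trans _ (frm_bound A uu)) //.
  rewrite (le_trans (real_ler_norm _)) ?Creal_Re //.
  by case: (leif_normC_Re_Creal (frm A u u)).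
have supS : has_sup S by split; [exists 0|exists (complex.Re b)].
pose t := sup S.
have t0 : 0 <= t by apply: ub_le_sup => //; exists (complex.Re b).
have St : S t.
  move=> w.
  have /choice[tj htj] : forall j : nat, exists s, S s /\ t - j.+1%:R^-1 < s.
    move=> j; have j0 : 0 < j.+1%:R^-1 :> R by rewrite invr_gt0.
    by have [s Ss ts] := sup_adherent j0 supS; exists s.
  apply: (semipos_lim FU).
    apply: (@cvg_mxlim_shift _ _ _ (fun j => (tj j)%:C) (fun=> w)).
      apply: (cvg_inv_bound FU Foo) => j; rewrite -raddfB /= normCr lecR.
      have [Sj hj] := htj j; rewrite ger0_norm.
        by rewrite lerBlDr -lerBlDl ltW.
      by rewrite subr_ge0 ub_le_sup //; exists (complex.Re b).
    exact: cvg_cst.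
  by move=> j; apply: (htj j).1.
exists t => //; split; first exact: St.
have /choice[w hw] : forall j : nat, exists w : C, `|w| = 1 /\
    semipos (n - k + 1) (- (w *: (A - (t + j.+1%:R^-1)%:C%:M))).
  move=> j; set B := A - _.
  have : ~ pencil_semipos k B.
    move=> SB; have : t + j.+1%:R^-1 <= t.
      by apply: ub_le_sup => //; exists (complex.Re b).
    by rewrite gerDl leNgt invr_gt0 ltr0n.
  move=> /existsNP[w hw].
  have w0 : w != 0.
    by apply: contra_notN hw => /eqP ->; rewrite scale0r -(scale0r A); exact: hA.
  exists (`|w|^-1 * w); split.
    by rewrite normrM normfV normr_id mulVf // normr_eq0.
  have kk : (1 <= k <= n)%N by rewrite k0.
  have [/hw//|[N uN hN]] := inertia_split (w *: B) kk.
  rewrite -scalerA -scalerN; apply: semiposZ; first by rewrite invr_ge0.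
  exists N => [|x xN]; first exact: unitary_row_free.
  have [->|x0] := eqVneq x 0; first by rewrite frm0l raddf0.
  by rewrite frmNm raddfN oppr_ge0 ltW // hN.
have [l hl] : exists l : C, (w : nat -> CT) @ F --> (l : CT).
  by apply: (@ultra_cvg R F w 1 FU) => j; rewrite -lecR modulusE (hw j).1.
exists l.
  apply/eqP => l0; move: hl; rewrite l0 => /cvgrPdist_le/(_ (2^-1)).
  rewrite invr_gt0 ltr0n => /(_ isT) /filter_ex[j].
  rewrite sub0r normrN (hw j).1 => h.
  have : (2 : C)^-1 < 1 by rewrite invf_lt1 // ltr1n.
  by move=> /(le_lt_trans h); rewrite ltxx.
apply: (semipos_lim FU _ (fun j => (hw j).2)).
rewrite -scaleNr.
rewrite [X in mxlim _ X _](_ : _ =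
   fun j => - w j *: (A - (t + j.+1%:R^-1)%:C%:M)); last first.
  by apply/funext => j; rewrite scaleNr.
apply: (@cvg_mxlim_shift _ _ _ (fun j => (t + j.+1%:R^-1)%:C) (fun j => - w j)).
  apply: (cvg_inv_bound FU Foo) => j.
  by rewrite -raddfB /= normCr lecR opprD addrA subrr add0r normrN ger0_norm.
exact: cvgN.
Qed.

Lemma pencil_semiposM k n (A : 'M[C]_n) (w : C) :
  pencil_semipos k A -> pencil_semipos k (w *: A).
Proof. by move=> hA v; rewrite scalerA; exact: hA. Qed.

(** Let [N] be the span of the eigenvectors of the Hermitian part with eigenvalue at
    most [0]; by the last hypothesis it has dimension at least [n - k]. For [w]
    close to [1], the nonnegative space of [w A] meets [N], and a unit vector [x]
    in common has [Re f <= 0] and [Re (w f) >= 0], with [f] the value of the form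
    at [x]. For [w = 1 - i s e] this forces [s * Im f >= 0], and [Re f] to tend to
    [0] with [e]. A limit of such [x] lies in the kernel. *)
Lemma kernel_direction k n (A : 'M[C]_n) (s : R) : `|s| = 1 ->
  pencil_semipos k.+1 A -> semipos (n - k.+1 + 1) (- A) ->
  exists x : 'rV[C]_n,
    [/\ x != 0, x *m (A + A^t*) = 0 & 0 <= s%:C * 'Im (frm A x x)].
Proof.
move=> s1 hA [M fM hM]; have [F FU Foo] := ultra_nat.
have kn : (k < n)%N by have [U fU _] := hA 1; exact: row_free_leq fU.
have [[U fU hU]|[N uN hN]] := inertia_split_kernel A kn.
  have [|x x0 [xU xM]] := meet_nonzero fU fM; first by lia.
  have := hM x xM; rewrite frmNm raddfN oppr_ge0 => /(lt_le_trans (hU x xU x0)).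
  by rewrite ltxx.
pose w j : C := 1 - ('i * s%:C) * (j.+1%:R^-1 : R)%:C.
have /choice[x hx] j : exists x : 'rV[C]_n,
    [/\ x \is unitarymx, (x <= N)%MS & 0 <= 'Re (w j * frm A x x)].
  have [U fU hU] := hA (w j).
  have [|x x0 [xU xN]] := meet_nonzero fU (unitary_row_free uN); first by lia.
  have [u uu eu] : exists2 u : 'rV[C]_n, u \is unitarymx & (u :=: x)%MS.
    by apply: unitarize; rewrite /row_free rank_rV x0.
  exists u; split=> //; first by rewrite eu.
  by rewrite -frmZm; apply: hU; rewrite eu.
have [y uy hy] := unitary_lim FU (fun j => let: And3 h _ _ := hx j in h).
have fy : (fun j => frm A (x j) (x j) : CT) @ F --> (frm A y y : CT).
  by apply: (mxlim_frm _ hy hy); exact: mxlim_cst.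
have wR j : 'Re (w j * frm A (x j) (x j)) =
    'Re (frm A (x j) (x j)) + (j.+1%:R^-1 : R)%:C * (s%:C * 'Im (frm A (x j) (x j))).
  rewrite mulrBl mul1r raddfB /= -!mulrA ReMil mulrCA.
  by rewrite !ImMl ?realCr // opprK mulrCA.
have yN : (y <= N)%MS.
  rewrite submxE; apply/eqP.
  have hc : mxlim F (fun j => x j *m cokermx N) (y *m cokermx N).
    by apply: (mxlimM hy); exact: mxlim_cst.
  apply: (mxlim_unique hc).
  rewrite [X in mxlim _ X _](_ : _ = fun=> 0); first exact: mxlim_cst.
  by apply/funext => j; apply/eqP; rewrite -submxE; case: (hx j).
have wf : (fun j => w j * frm A (x j) (x j) : CT) @ F --> (frm A y y : CT).
  rewrite -[frm A y y]mul1r; apply: cvgM fy.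
  rewrite /w; under [X in X @ _]funext do rewrite -mulNr.
  by apply: cvg_add_inv => //; rewrite normrN normrM normCi normCr s1 mulr1.
have [Rle keryN] := hN y yN.
exists y; split.
- by have := mxrank_unitary uy; rewrite rank_rV; case: (y != 0).
- apply: keryN; apply/eqP; rewrite eq_le Rle /=.
  by apply: (cvg_Re_ge0 _ wf); apply: nearW => j; case: (hx j).
have -> : s%:C * 'Im (frm A y y) = 'Re (- 'i * s%:C * frm A y y).
  by rewrite -mulrA mulNr raddfN /= ReMil opprK ImMl ?realCr.
apply: (@cvg_Re_ge0 _ F _ (fun j => - 'i * s%:C * frm A (x j) (x j))).
  apply: nearW => j; rewrite -mulrA mulNr raddfN /= ReMil opprK ImMl ?realCr //.
  have [_ xN] := hx j; rewrite wR.
  have j0 : 0 < (j.+1%:R^-1 : R)%:C :> C by rewrite ltcR invr_gt0.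
  have [h _] := hN _ xN.
  move=> h'; rewrite -(pmulr_rge0 _ j0); apply: le_trans h' _.
  by rewrite gerDr.
by apply: cvgM fy; exact: cvg_cst.
Qed.

(** The Li-Sze theorem. The reduced matrix satisfies the hypothesis for non-real [z]
    by [semipos_null_reduce], and for real [z] by approximation. *)
Lemma pencil_semipos_isotropic k n (A : 'M[C]_n) :
  pencil_semipos k A -> isotropic k A.
Proof.
have [F FU Foo] := ultra_nat.
elim: k n A => [|k IHk] n A hA.
  by exists 0; rewrite ?mul0mx // /row_free mxrank0.
have extremal (B : 'M[C]_n) : pencil_semipos k.+1 B ->
    exists2 t : R, 0 <= t & isotropic k.+1 (B - t%:C%:M).
  move=> /extremal_shift[//|t t0 [hBt [w w0 hw]]]; exists t => //.
  apply: (isotropicZ w0); set D := w *: _ in hw *.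
  have hD : pencil_semipos k.+1 D by exact: pencil_semiposM.
  have [x1 [x10 x1D]] := kernel_direction (normr1 R) hD hw.
  rewrite mul1r => I1.
  have [x2 [x20 x2D]] := kernel_direction (normrN1 R) hD hw.
  rewrite rmorphN1 mulN1r oppr_ge0 => I2.
  have [v [v0 vD vv]] := neutral_vector x10 x1D I1 x20 x2D I2.
  have [m [W [fW vW vDW spanW _]]] := isotropic_complement v0 vv.
  apply: (isotropic_extend v0 fW vW vv vDW).
    apply: (@ctr_inj _ _ _); rewrite /= !ctrM trmxCK mulmxA vD mulNmx vDW.
    by rewrite oppr0 ctr0.
  apply: IHk => z; have [Iz|Iz] := eqVneq ('Im z) 0; last first.
    exact: (semipos_null_reduce v0 vD vv fW vDW spanW Iz).
  pose z_ j : C := z + 'i * (j.+1%:R^-1 : R)%:C.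
  apply: (@semipos_lim _ F FU _ _ (fun j => z_ j *: (W *m D *m W^t*))).
    apply: (@mxlimZ C F _ _ _ z_); last exact: mxlim_cst.
    by apply: cvg_add_inv => //; rewrite normCi.
  move=> j; apply: (semipos_null_reduce v0 vD vv fW vDW spanW _ (hD _)).
  rewrite /z_ raddfD /= Iz add0r ImMil (Creal_ReP _ (realCr _)).
  by rewrite gt_eqF // ltcR invr_gt0.
have [t t0 ht] := extremal A hA.
have [s s0 hs] : exists2 s : R, 0 <= s & isotropic k.+1 (- A - s%:C%:M).
  by apply: extremal; rewrite -scaleN1r; exact: pencil_semiposM.
apply: (isotropic_between t0 s0 ht).
apply: (@isotropicZ _ _ _ _ (-1)); first by rewrite oppr_eq0 oner_eq0.
by rewrite scaleN1r opprD.
Qed.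

(** * The inner radius and the choice of the isometries *)
Lemma isometry_unitary n m (X : 'M[C]_(n, m)) :
  isometries X <-> X^t* \is unitarymx.
Proof.
by split=> [h|/unitarymxP]; [apply/unitarymxP|]; rewrite ?trmxCK // => h.
Qed.

Lemma rank_numrangeP n k (A : 'M[C]_n) z :
  rank_numrange k A z <-> isotropic k (A - z%:M).
Proof.
split=> [[X /isometry_unitary uX XA]|[U' fU' hU']].
  exists (X^t*); first exact: unitary_row_free.
  rewrite trmxCK mulmxBr mulmxBl XA mul_mx_scalar -scalemxAl.
  by have := unitarymxP uX; rewrite trmxCK => ->; rewrite scalemx1 subrr.
have [U uU eU] := unitarize fU'; exists (U^t*).
  by apply/isometry_unitary; rewrite trmxCK.
have /eqP : U *m (A - z%:M) *m U^t* = 0 by apply: sub_isotropic hU'; rewrite eU.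
rewrite mulmxBr mulmxBl mul_mx_scalar -scalemxAl (unitarymxP uU) scalemx1.
by rewrite subr_eq0 trmxCK => /eqP.
Qed.

Lemma rank_numrange_lim n k (A : 'M[C]_n) (F : set_system nat) (f : nat -> C) z :
  UltraFilter F -> (f : nat -> CT) @ F --> (z : CT) ->
  (forall j, rank_numrange k A (f j)) -> rank_numrange k A z.
Proof.
move=> FU fz hf; apply/rank_numrangeP; rewrite -[A - _]scale1r.
apply: (@isotropic_lim _ F FU _ _ (fun j => 1 *: (A - (f j)%:M))).
  by apply: (@cvg_mxlim_shift _ _ _ f (fun=> 1)); [exact: fz|exact: cvg_cst].
by move=> j; rewrite scale1r; apply/rank_numrangeP.
Qed.

Lemma modulus_ge0 (z : C) : 0 <= modulus z.
Proof. by rewrite -ler0c modulusE. Qed.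

Lemma modulus_lim (F : set_system nat) (f : nat -> C) z (r : R) :
  ProperFilter F -> (f : nat -> CT) @ F --> (z : CT) ->
  (forall j, modulus (f j) <= r) -> modulus z <= r.
Proof.
move=> FF /cvgrPdist_le fz fr; apply/ler_addgt0Pr => e e0.
have eC : 0 < e%:C :> C by rewrite ltcR.
have [j hj] := filter_ex (fz _ eC).
rewrite -lecR modulusE -[z](subrK (f j)) (le_trans (ler_normD _ _)) //.
by rewrite addrC raddfD /= lerD // -modulusE lecR.
Qed.

(** A minimizing sequence is bounded, and the limit stays in the closed set. *)
Lemma closest_point n k (A : 'M[C]_n) : rank_numrange k A !=set0 ->
  exists2 z0, rank_numrange k A z0 &
    forall z, rank_numrange k A z -> modulus z0 <= modulus z.
Proof.
move=> [z1 hz1]; have [F FU Foo] := ultra_nat.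
pose S := [set modulus z | z in rank_numrange k A].
have lS : lbound S 0 by move=> _ [z _ <-]; exact: modulus_ge0.
have iS : has_inf S by split; [exists (modulus z1); exists z1|exists 0].
have /choice[f hf] (j : nat) :
    exists z, rank_numrange k A z /\ modulus z < inf S + j.+1%:R^-1.
  have j0 : 0 < j.+1%:R^-1 :> R by rewrite invr_gt0.
  by have [_ [z hz <-] zj] := inf_adherent j0 iS; exists z.
have [z0 hz0] : exists l : C, (f : nat -> CT) @ F --> (l : CT).
  apply: (@ultra_cvg R F f (inf S + 1) FU) => j.
  apply: ltW; apply: lt_le_trans (hf j).2 _.
  by rewrite lerD2l invf_le1 ?ler1n ?ltr0n.
exists z0; first exact: (rank_numrange_lim FU hz0 (fun j => (hf j).1)).
move=> z hz; apply: (@le_trans _ _ (inf S)); last first.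
  by apply: ge_inf; [exists 0|exists z].
apply/ler_addgt0Pr => e e0.
have eC : 0 < (e / 2)%:C :> C by rewrite ltcR divr_gt0.
have e2 : 0 < e / 2 by rewrite divr_gt0.
have h1 : \forall j \near F, `|z0 - f j| <= (e / 2)%:C.
  by move/cvgrPdist_le: hz0; exact.
have h2 : \forall j \near F, j.+1%:R^-1 < e / 2.
  by apply: Foo; exact: (near_infty_natSinv_lt (PosNum e2)).
have [j [j1 j2]] := filter_ex (filterI h1 h2).
rewrite -lecR modulusE -[z0](subrK (f j)) (le_trans (ler_normD _ _)) //.
have -> : inf S + e = e / 2 + (inf S + e / 2) by rewrite addrCA -splitr.
rewrite raddfD /= lerD //.
by rewrite -modulusE lecR ltW // (lt_trans (hf j).2) // ltrD2l.
Qed.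

(** A closest point [z0] is not interior, for otherwise [(1 - d) z0] would be
    closer to [0] for small [d]; and every boundary point belongs to the set,
    which is closed. *)
Lemma inner_rank_radiusE n k (A : 'M[C]_n) z0 : z0 != 0 ->
  rank_numrange k A z0 ->
  (forall z, rank_numrange k A z -> modulus z0 <= modulus z) ->
  inner_rank_radius k A = modulus z0.
Proof.
move=> z00 hz0 minz0; have [F FU Foo] := ultra_nat.
apply: set_minimumE.
  exists z0 => //; split; first exact: subset_closure.
  rewrite /interior => /nbhs_ballP[e /= e0 he].
  have eE : e = (complex.Re e)%:C by rewrite RRe_real // gtr0_real.
  rewrite eE ltcR in e0.
  have m0 : 0 < modulus z0 by rewrite -ltcR modulusE normr_gt0.
  pose d := Num.min 1 (complex.Re e / modulus z0) / 2.
  have d0 : 0 < d by rewrite divr_gt0 // lt_min ltr01 divr_gt0.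
  have d1 : d < 1.
    by rewrite ltr_pdivrMr // mul1r (@le_lt_trans _ _ 1) ?ge_min ?lexx // ltr1n.
  have dm : d * modulus z0 < complex.Re e.
    rewrite -ltr_pdivlMr // ltr_pdivrMr //.
    apply: (@le_lt_trans _ _ (complex.Re e / modulus z0)).
      by rewrite ge_min lexx orbT.
    by rewrite ltr_pMr ?ltr1n // divr_gt0.
  have : rank_numrange k A ((1 - d)%:C * z0).
    apply: he; rewrite /ball /= /ball_ /=.
    have -> : z0 - (1 - d)%:C * z0 = d%:C * z0.
      by rewrite raddfB /= mulrBl mul1r opprB addrC subrK.
    have : `|d%:C * z0 : C| < e.
      by rewrite normrM normCr [`|d|]gtr0_norm // -modulusE -rmorphM eE ltcR.
    exact.
  move=> /minz0; rewrite -lecR !modulusE normrM normCr -modulusE -rmorphM lecR.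
  have d1' : 0 <= 1 - d by rewrite subr_ge0 ltW.
  rewrite ger0_norm // mulrBl mul1r leNgt gtrBl.
  by rewrite mulr_gt0.
move=> _ [z [clz _] <-]; apply: minz0.
have /choice[f hf] (j : nat) :
    exists y, rank_numrange k A y /\ `|z - y| <= (j.+1%:R^-1)%:C.
  have j0 : 0 < (j.+1%:R^-1 : R)%:C :> C by rewrite ltcR invr_gt0.
  have [y [hy zy]] := clz _ (nbhsx_ballx (z : CT) _ j0).
  by exists y; split => //; exact: ltW.
have fz : (f : nat -> CT) @ F --> (z : CT).
  by apply: (cvg_inv_bound FU Foo) => j; exact: (hf j).2.
exact: (rank_numrange_lim FU fz (fun j => (hf j).1)).
Qed.

Lemma exists_isometry n m : (m <= n)%N -> exists M : 'M[C]_(n, m), isometries M.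
Proof.
move=> mn; have [|U fU _] := @subspace_dim C m n n (1%:M); first by rewrite mxrank1.
have [V uV _] := unitarize fU.
by exists (V^t*); apply/isometry_unitary; rewrite trmxCK.
Qed.

(** A subspace of dimension [k] and one of dimension [n - k + 1] share a unit vector,
    at which the form of [A] takes the value [z]. *)
Lemma rank_numrange_sub_numrange n k (A : 'M[C]_n) (M : 'M[C]_(n, n - k + 1)) :
  (k <= n)%N -> isometries M ->
  rank_numrange k A `<=` numrange (M^t* *m A *m M).
Proof.
move=> kn /isometry_unitary uM z /rank_numrangeP[U fU hU].
have [|x x0 [xU /submxP[y xE]]] := meet_nonzero fU (unitary_row_free uM).
  by lia.
have y0 : row_free y.
  rewrite /row_free rank_rV; apply/eqP; case: eqP => // y0.
  by move: x0; rewrite xE y0 mul0mx eqxx.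
have [v uv ev] := unitarize y0.
exists (v^t*); first by apply/isometry_unitary; rewrite trmxCK.
have vMU : (v *m M^t* <= U)%MS.
  by apply: submx_trans xU; rewrite xE submxMr // ev.
have : frm (A - z%:M) (v *m M^t*) (v *m M^t*) = 0.
  by rewrite /frm (sub_isotropic vMU hU) mxE.
rewrite frm_shift frm1_unitary ?mul_unitarymx // mulr1 => /eqP.
rewrite subr_eq0 => /eqP <-.
by rewrite /frm ctrM !trmxCK !mulmxA.
Qed.

(** Compressing to the span of the negative eigenvectors of the Hermitian part of
    [w A - q] cuts off the half-plane [Re (w z) > q]. *)
Lemma halfplane_isometry n k (A : 'M[C]_n) (w : C) (q : R) : (1 <= k <= n)%N ->
  ~ semipos k (w *: A - q%:C%:M) ->
  exists2 M : 'M[C]_(n, n - k + 1), isometries M &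
    forall z, numrange (M^t* *m A *m M) z -> 'Re (w * z) <= q%:C.
Proof.
move=> kn nB; have [//|[N uN hN]] := inertia_split (w *: A - q%:C%:M) kn.
exists (N^t*); first by apply/isometry_unitary; rewrite trmxCK.
move=> z [x /isometry_unitary ux <-].
have uxN : x^t* *m N \is unitarymx by apply: mul_unitarymx.
have x0 : x^t* *m N != 0.
  by have := mxrank_unitary uxN; rewrite rank_rV; case: (_ != 0).
have := hN _ (submxMl _ _) x0; rewrite frm_shift frm1_unitary // mulr1 frmZm.
rewrite raddfB /= (Creal_ReP _ (realCr q)) subr_lt0 => /ltW.
by rewrite /frm ctrM !trmxCK !mulmxA.
Qed.

Lemma Re_complex (z : C) : 'Re z = (complex.Re z)%:C.
Proof. by rewrite ReJ_add ReE. Qed.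

(** The Li-Sze condition at [z] in direction [w] says that the form of
    [w A - q] is nonnegative on some subspace of dimension [k] for every real [q]
    below [Re (w z)]. It is enough to know this for rational [w] and [q], as the
    condition is closed. *)
Lemma rational_cuts n k (A : 'M[C]_n) z :
  (forall a b q : rat, ~ semipos k
     ((ratr a +i* ratr b)%C *: A - (ratr q : R)%:C%:M) ->
     'Re ((ratr a +i* ratr b)%C * z) <= (ratr q : R)%:C) ->
  rank_numrange k A z.
Proof.
move=> hz; have [F FU Foo] := ultra_nat.
apply/rank_numrangeP; apply: pencil_semipos_isotropic => w.
have rat_near (x e : R) : 0 < e -> exists q : rat, x - e <= ratr q < x.
  move=> e0; have [|q] := @rat_in_itvoo R (x - e) x; first by rewrite gtrBl.
  by rewrite in_itv /= => /andP[/ltW h1 h2]; exists q; rewrite h1.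
have j2 (j : nat) : 0 < j.+1%:R^-1 / 2 :> R by rewrite divr_gt0 ?invr_gt0.
have /choice[a ha] (j : nat) := rat_near (complex.Re w) _ (j2 j).
have /choice[b hb] (j : nat) := rat_near (complex.Im w) _ (j2 j).
pose v j : C := (ratr (a j) +i* ratr (b j))%C.
have cv : (v : nat -> CT) @ F --> (w : CT).
  apply: (cvg_inv_bound FU Foo) => j.
  have -> : w - v j = (complex.Re w - ratr (a j))%:C
                      + 'i%C * (complex.Im w - ratr (b j))%:C.
    by rewrite [LHS]complexE; case: (w).
  rewrite (le_trans (ler_normD _ _)) // normrM normci mul1r !normCr.
  rewrite -raddfD /= lecR [leRHS]splitr.
  have /andP[a1 /ltW a2] := ha j; have /andP[b1 /ltW b2] := hb j.
  by rewrite lerD // ger0_norm ?subr_ge0 // lerBlDl -lerBlDr.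
have j0 (j : nat) : 0 < j.+1%:R^-1 :> R by rewrite invr_gt0.
have /choice[q hq] (j : nat) := rat_near (complex.Re (v j * z)) _ (j0 j).
(* The term in [1 / (j + 1)] absorbs the gap between [q j] and [Re (v j * z)]. *)
pose B j := v j *: (A - z%:M) + (j.+1%:R^-1 : R)%:C *: 1%:M.
apply: (@semipos_lim _ F FU _ _ B) => [|j].
  suff : mxlim F B (w *: (A - z%:M) + 0 *: 1%:M) by rewrite scale0r addr0.
  apply: (@mxlimD C F _ _ _ (fun j => v j *: (A - z%:M))).
    by apply: (@cvg_mxlim_shift _ _ _ (fun=> z)); [exact: cvg_cst|exact: cv].
  apply: (@mxlimZ C F _ _ _ (fun j => (j.+1%:R^-1 : R)%:C)); last exact: mxlim_cst.
  apply: (cvg_inv_bound FU Foo) => j.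
  by rewrite sub0r normrN normCr ger0_norm // ltW.
have /andP[q1 q2] := hq j.
have [U fU hU] : semipos k (v j *: A - (ratr (q j) : R)%:C%:M).
  apply: contrapT => /hz; rewrite -/(v j) Re_complex lecR.
  by rewrite leNgt q2.
exists U => // x /hU; rewrite frm_shift frmZm.
have -> : frm (B j) x x = v j * frm A x x - v j * z * frm 1%:M x x
                          + (j.+1%:R^-1 : R)%:C * frm 1%:M x x.
  by rewrite /B frmDm frmZm frm_shift frmZm mulrBr mulrA.
move: (frm A x x) (frm 1%:M x x) (frm1_ge0 x) => f g g0 h; apply: le_trans h _.
rewrite -addrA !raddfD /= lerD2l !raddfN /=.
have gR : g \is Num.real by exact: ger0_real.
rewrite (ReMr gR (v j * z)) (ReMr gR (j.+1%:R^-1 : R)%:C) (ReMr gR (ratr (q j))%:C).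
rewrite (Re_complex (v j * z)) !(Creal_ReP _ (realCr _)).
rewrite -!mulNr -[leRHS]mulrDl ler_wpM2r // -!rmorphN -rmorphD lecR.
by rewrite rmorphN lerNl opprD opprK.
Qed.

Lemma le_inf_subset (S T : set R) : S !=set0 -> S `<=` T -> lbound T 0 ->
  inf T <= inf S.
Proof.
move=> S0 ST lT; apply: lb_le_inf => // x /ST Tx.
by apply: ge_inf => //; exists 0.
Qed.

(** There are countably many rational half-planes; the ones that can be cut off are
    enumerated through the encoding of triples of rationals. *)
Lemma cutting_isometries n k (A : 'M[C]_n) : (1 <= k <= n)%N ->
  exists2 M : nat -> 'M[C]_(n, n - k + 1), forall p, isometries (M p) &
    forall (F : set_system nat) (f : nat -> C) (z : C),
      UltraFilter F -> \oo `<=` F -> (f : nat -> CT) @ F --> (z : CT) ->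
      (forall j, numrange_cap A M j.+1 (f j)) -> rank_numrange k A z.
Proof.
move=> hk.
pose bad (c : rat * rat * rat) := ~ semipos k
  ((ratr c.1.1 +i* ratr c.1.2)%C *: A - (ratr c.2 : R)%:C%:M).
(* The intersections start at [p = 1], hence the successor of the code. *)
have /choice[M hM] (p : nat) : exists M : 'M[C]_(n, n - k + 1), isometries M /\
    forall c, p = (pickle c).+1 -> bad c ->
      forall z, numrange (M^t* *m A *m M) z ->
        'Re ((ratr c.1.1 +i* ratr c.1.2)%C * z) <= (ratr c.2 : R)%:C.
  have [[c [pc badc]]|none] := pselect (exists c, p = (pickle c).+1 /\ bad c).
    have [M uM hM] := halfplane_isometry hk badc.
    exists M; split => // c' pc' _; suff -> : c' = c by [].
    by apply: (pcan_inj pickleK); move: pc'; rewrite pc => -[].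
  have [|M uM] := @exists_isometry n (n - k + 1); first by lia.
  by exists M; split=> // c pc badc; case: none; exists c.
exists M => [p|F f z FU Foo fz hf]; first exact: (hM p).1.
apply: rational_cuts => a b q badc; pose c := (a, b, q).
have [_ hc] := hM (pickle c).+1; have {}hc := hc c erefl badc.
rewrite -subr_ge0 -(Creal_ReP _ (realCr (ratr q))) -raddfB /=.
apply: (@cvg_Re_ge0 _ F _
  (fun j => (ratr q)%:C - (ratr a +i* ratr b)%C * f j)); last first.
  by apply: cvgB; [exact: cvg_cst|apply: cvgM; [exact: cvg_cst|exact: fz]].
apply: Foo; exists (pickle c) => // j /= jc.
rewrite raddfB /= (Creal_ReP _ (realCr (ratr q))) subr_ge0; apply: hc.
by apply: (hf j); rewrite /= ltnS.
Qed.

End HigherRank.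

Theorem theorem3p2 (R : realType) (n k : nat) (hk : (1 <= k <= n)%N)
    (A : 'M[R[i]]_n) (hA : rank_numrange k A !=set0)
    (h0 : ~ rank_numrange k A 0) :
  exists M : nat -> 'M[R[i]]_(n, (n - k + 1)%N),
    (forall p, (1 <= p)%N -> isometries (M p)) /\
    (cap_dist A M nu @[nu --> \oo] --> inner_rank_radius k A) /\
    sup [set cap_dist A M nu | nu in [set nu | (1 <= nu)%N]]
      = inner_rank_radius k A.
Proof.
have [_ kn] := andP hk; have [F FU Foo] := ultra_nat.
have [z0 hz0 minz0] := closest_point hA.
have z00 : z0 != 0 by apply: contra_notN h0 => /eqP <-.
rewrite (inner_rank_radiusE z00 hz0 minz0); set d := modulus z0.
have [M uM hM] := cutting_isometries A hk.
exists M; split; first by move=> p _; exact: uM.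
pose D nu := [set modulus z | z in numrange_cap A M nu].
have Dd nu : D nu d.
  by exists z0 => // p _; apply: rank_numrange_sub_numrange.
have lD nu : lbound (D nu) 0 by move=> _ [z _ <-]; exact: modulus_ge0.
have cap_le nu : cap_dist A M nu <= d.
  by apply: ge_inf; [exists 0; exact: lD|exact: Dd].
have cap_mono nu nu' : (nu <= nu')%N -> cap_dist A M nu <= cap_dist A M nu'.
  move=> le; apply: le_inf_subset; [by exists d; exact: Dd| |exact: lD].
  move=> _ [z hz <-]; exists z => // p /andP[p1 pn]; apply: hz.
  by rewrite /= p1 (leq_trans pn).
set S := [set _ | _ in _].
have S1 : S (cap_dist A M 1) by exists 1%N.
have ubS : ubound S d by move=> _ [nu _ <-]; exact: cap_le.
have supS : has_sup S by split; [exists (cap_dist A M 1)|exists d].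
have supd : sup S = d.
  apply/eqP; rewrite eq_le ge_sup //=; last by exists (cap_dist A M 1).
  rewrite leNgt; apply/negP => sd.
  pose r := (sup S + d) / 2.
  have sr : sup S < r by rewrite midf_lt.
  have rd : r < d by rewrite midf_lt.
  have /choice[f hf] (j : nat) :
      exists z, numrange_cap A M j.+1 z /\ modulus z <= r.
    have cr : cap_dist A M j.+1 < r.
      by apply: le_lt_trans sr; apply: ub_le_sup; [exists d|exists j.+1].
    have D0 : D j.+1 !=set0 by exists d; exact: Dd.
    have [_ [z hz <-] zr] := inf_lt D0 cr.
    by exists z; split => //; exact: ltW.
  have [z hz] := ultra_cvg FU (fun j => (hf j).2).
  have := minz0 z (hM F f z FU Foo hz (fun j => (hf j).1)).
  rewrite leNgt => /negP; apply; apply: le_lt_trans rd.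
  exact: (modulus_lim _ hz (fun j => (hf j).2)).
split=> //; apply/cvgrPdist_le => e e0.
have [_ [nu0 nu1 <-] hnu] := sup_adherent e0 supS.
exists nu0 => // nu /= nunu; rewrite ger0_norm ?subr_ge0 //.
rewrite lerBlDr -lerBlDl -supd; apply: ltW; apply: lt_le_trans hnu _.
exact: cap_mono.
Qed.
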